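(* Let $X_1,\dots,X_n\in\mathbb{R}^p$ and $Y_1,\dots,Y_n\in\mathbb{R}^p$ be random vectors satisfying the standing assumptions listed in the context, let $R_1,\dots,R_n>0$ be deterministic, let $A$ be a deterministic positive definite $p\times p$ matrix with $A\succeq t\,\mathrm{Id}_p$ for some $t>0$, let $\Sigma_\varepsilon$ be a deterministic positive semidefinite $p\times p$ matrix, and let $x\in\mathbb{R}^p$ be deterministic. Let $M=\frac1n\sum_{i=1}^nR_i^2X_iX_i^\top+A$, $$F(X)=x^\top M^{-1}\Sigma_\varepsilon M^{-1}x,\qquad b(A;\Sigma_\varepsilon)=\|A^{-1/2}\Sigma_\varepsilon A^{-1/2}\|_{op},$$ and define $F(Y)$ in the same way with the $Y_i$ in place of the $X_i$. Then, for a numerical constant $K$, $$\mathrm{var}(F(X))\le K\,(x^\top A^{-1}x)^2\,b(A;\Sigma_\varepsilon)^2\sum_{i=1}^n\left[\frac{R_i^4}{n^2}\frac1{t^2}b_L(4;X_i)\wedge1\right].$$ Also, $$\left|\mathbb{E}[F(X)-F(Y)]\right|\le\sum_{i=1}^n\big(U_i(X_i)+U_i(Y_i)\big),$$ where $$U_i(X_i)\le K\,b(A;\Sigma_\varepsilon)\frac{x^\top A^{-1}x}{t}\left\{\left[\frac{R_i^4}{n^{3/2}}\sqrt{\frac{b_{Q_2}(2;X_i)}{n}}\sqrt{b_L(4;X_i)}\,\frac1t\right]\wedge\left[\frac{R_i^2}{n}b_L(2;X_i)\right]\right\},$$ and $U_i(Y_i)$ satisfies the same bound with $Y_i$ in place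 of $X_i$.
   Context: Notation: $a\wedge b=\min(a,b)$; $\succeq$ is the Loewner order; $\|\cdot\|_{op}$ is the operator norm. Standing assumptions: the ratio $p/n$ stays bounded away from $0$ and $\infty$; the $X_j$ are independent, the $Y_j$ are independent, and the $Y_j$'s are independent of the $X_j$'s; for each $j$, $X_j$ and $Y_j$ have mean $0$ and the same covariance matrix $\Sigma_j$. For $Z\in\{X_j,Y_j\}$ and $k\ge1$, $b_L(k;Z)$ and $b_{Q_2}(k;Z)$ are deterministic numbers (finite for the exponents that appear) such that $\mathbb{E}|Z^\top v|^k\le b_L(k;Z)$ for every deterministic unit vector $v$, and $\mathbb{E}|Z^\top MZ-\mathbb{E}[Z^\top MZ]|^k\le b_{Q_2}(k;Z)$ for every deterministic positive semidefinite $M$ with $\|M\|_{op}\le1$. Without loss of generality $b_L(k;Z)\le\sqrt{b_L(2k;Z)}$. *)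

(* Defs.v *)
From HB Require Import structures.
From mathcomp Require Import all_boot all_order all_algebra.
From mathcomp Require Import all_classical all_reals all_analysis.

Set Implicit Arguments.
Unset Strict Implicit.
Unset Printing Implicit Defensive.

Import Order.TTheory GRing.Theory Num.Theory.
Import numFieldTopology.Exports numFieldNormedType.Exports.

Local Open Scope classical_set_scope.
Local Open Scope ring_scope.

Section LinearAlgebra.
Context {R : realType} {p : nat}.
Implicit Types (A B M S : 'M[R]_p) (u v x : 'cV[R]_p).

Definition dot u v : R := (u^T *m v) 0 0.

(* [`|v|] is the library's sup norm, hence a separate Euclidean norm. *)
Definition enorm v : R := Num.sqrt (dot v v).

Definition quad M v : R := dot v (M *m v).

Definition psdmx M : Prop := M^T = M /\ forall v, 0 <= quad M v.

Definition posdefmx M : Prop := M^T = M /\ forall v, v != 0 -> 0 < quad M v.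

Definition loewner_le A B : Prop := psdmx (B - A).

Definition opnorm M : R := sup [set enorm (M *m v) | v in [set v | enorm v = 1]].

(* The unique positive semidefinite square root when [A] is positive
   semidefinite; the default value 0 is only taken for other matrices. *)
Definition sqrtmx A : 'M[R]_p := xget 0 [set S | psdmx S /\ S *m S = A].

Definition invsqrtmx A : 'M[R]_p := invmx (sqrtmx A).

Definition b_eps A Sigma_eps : R :=
  opnorm (invsqrtmx A *m Sigma_eps *m invsqrtmx A).

Definition Mmx (n : nat) (rad : 'I_n -> R) A (z : 'I_n -> 'cV[R]_p) : 'M[R]_p :=
  n%:R^-1 *: (\sum_(i < n) rad i ^+ 2 *: (z i *m (z i)^T)) + A.

Definition Ffun (n : nat) (rad : 'I_n -> R) A Sigma_eps x
    (z : 'I_n -> 'cV[R]_p) : R :=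
  let Minv := invmx (Mmx rad A z) in dot x (Minv *m Sigma_eps *m Minv *m x).

End LinearAlgebra.

Section Probability.
Context {d : measure_display} {T : measurableType d} {R : realType}.
Variable P : probability T R.

Definition borel_cV (p : nat) : set (set 'cV[R]_p) := <<s [set B | open B] >>.

Definition random_vector (p : nat) (Z : T -> 'cV[R]_p) : Prop :=
  forall B, borel_cV B -> measurable (Z @^-1` B).

Definition sigma_of (p : nat) (Z : T -> 'cV[R]_p) : set (set T) :=
  preimage_set_system setT Z (@borel_cV p).

Definition sigma_of_family (p : nat) (I : Type) (Z : I -> T -> 'cV[R]_p) :
  set (set T) := <<s \bigcup_i sigma_of (Z i) >>.

Definition independent_vectors (p : nat) (I : finType)
    (Z : I -> T -> 'cV[R]_p) : Prop :=
  forall (J : {set I}) (E : I -> set T),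
    (forall i, i \in J -> sigma_of (Z i) (E i)) ->
    P (\big[setI/setT]_(i in J) E i) = \big[*%E/1%E]_(i in J) P (E i).

Definition independent_families (p : nat) (I J : Type)
    (Z : I -> T -> 'cV[R]_p) (W : J -> T -> 'cV[R]_p) : Prop :=
  forall E E', sigma_of_family Z E -> sigma_of_family W E' ->
    P (E `&` E') = (P E * P E')%E.

Definition has_mean0 (p : nat) (Z : T -> 'cV[R]_p) : Prop :=
  forall k, ('E_P[fun w => Z w k 0%R] = 0)%E.

Definition has_covmx (p : nat) (Z : T -> 'cV[R]_p) (Sigma : 'M[R]_p) : Prop :=
  forall k l,
    covariance P (fun w => Z w k 0) (fun w => Z w l 0) = (Sigma k l)%:E.

(* The numbers b_L(k; Z) are [\bar R]-valued: not all moments of [Z] need be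
   finite. *)
Definition linear_moment_bound (p : nat) (Z : T -> 'cV[R]_p)
    (bL : nat -> \bar R) : Prop :=
  forall k, (1 <= k)%N -> forall v : 'cV[R]_p, enorm v = 1 ->
    ('E_P[(fun w => `|dot (Z w) v| ^+ k)%R] <= bL k)%E.

Definition quadratic_moment_bound (p : nat) (Z : T -> 'cV[R]_p)
    (bQ2 : nat -> \bar R) : Prop :=
  forall k, (1 <= k)%N -> forall M : 'M[R]_p, psdmx M -> opnorm M <= 1 ->
    let EZMZ := fine 'E_P[fun w => quad M (Z w)]%E in
    ('E_P[(fun w => `|quad M (Z w) - EZMZ| ^+ k)%R] <= bQ2 k)%E.

Definition moment_controls (p : nat) (Z : T -> 'cV[R]_p)
    (bL bQ2 : nat -> \bar R) : Prop :=
  [/\ linear_moment_bound Z bL,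
      quadratic_moment_bound Z bQ2,
      [/\ bL 2%N \is a fin_num, bL 4%N \is a fin_num & bQ2 2%N \is a fin_num]
    & forall k, (1 <= k)%N -> (bL k <= sqrte (bL (2 * k)%N))%E].

End Probability.

(* [bxt] stands for b(A; Sigma_eps) * (x^T A^-1 x) / t, [r] for R_i, and [bL],
   [bQ2] for b_L(.; Z), b_{Q_2}(.; Z). *)
Definition swap_bound {R : realType} (K bxt t : R) (n : nat) (r : R)
    (bL bQ2 : nat -> \bar R) : R :=
  K * bxt *
  Num.min
    (r ^+ 4 / n%:R `^ (3 / 2) * Num.sqrt (fine (bQ2 2%N) / n%:R)
       * Num.sqrt (fine (bL 4%N)) * t^-1)
    (r ^+ 2 / n%:R * fine (bL 2%N)).

(* Main.v *)
Require Import Defs.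
From HB Require Import structures.
From mathcomp Require Import all_boot all_order all_algebra.
From mathcomp Require Import all_classical all_reals all_analysis.
From mathcomp Require Import measurable_realfun.
From mathcomp Require Import ring lra.

(** Write [a = R_i^2 / n], let [M0] be the matrix [M] in which the vector [z]
    with index [i] is replaced by zero, and [G = M0^-1]. Since [M0] dominates
    [A] and [t Id], and [Sigma_eps <= b A] by definition of [b = b(A; Sigma_eps)],
    the Sherman-Morrison formula shows that inserting [z] changes [F] by
<<
      D(z) = - 2 a l m / (1 + a q) + a^2 l^2 k / (1 + a q)^2,
>>
    where [l = z' G x] and [m = z' G Sigma_eps G x] are linear in [z], with
    coefficient vectors of square norm at most [x' A^-1 x / t] and
    [b^2 x' A^-1 x / t], and [q = z' G z], [k = z' G Sigma_eps G z] are
    quadratic, with [k <= b q]. The denominators absorb [q] and [k], whence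
    [|D| <= 2 a |l m| + a b l^2], and in any case [0 <= F <= b x' A^-1 x].

    Variance. The conditional second moment of [D] given the other vectors is
    bounded by fourth moments of linear forms, or trivially by
    [(b x' A^-1 x)^2], and the Efron-Stein inequality ([efron_stein]) sums these
    bounds. That inequality is proved by averaging the function over its
    coordinates one after the other: each step loses in second moment at most
    the mean square distance to a function that ignores the coordinate.

    Means. The vectors of one family are swapped for those of the other one at a
    time. In a swap, [q] and [k] in [D] are replaced by their means
    ([rank1_change_mean]); the result has an expectation that depends only on the
    covariance of [z], so it cancels between [X_i] and [Y_i]. The replacement
    costs [|q - E q|] and [|k - E k|], which the Cauchy-Schwarz inequality pairs
    with [l m] and [l^2]; this gives the first bound in the minimum. Bounding [D]
    and its replacement separately gives the second.

    Both parts condition on the other vectors through [E_resample]: replacing one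
    coordinate by an independent copy preserves the joint law, because this holds
    on rectangles. The inequality [Sigma_eps <= b A] needs an actual positive
    semidefinite square root of [A], obtained by splitting off eigenvectors that
    maximise the Rayleigh quotient ([psd_sqrt_exists]). *)

Set Implicit Arguments.
Unset Strict Implicit.
Unset Printing Implicit Defensive.

Import Order.TTheory GRing.Theory Num.Theory.
Import numFieldTopology.Exports numFieldNormedType.Exports.

Local Open Scope classical_set_scope.
Local Open Scope ring_scope.

(** * Inner products and positive semidefinite forms *)

(** Evaluate the quadratic at its minimiser or, if it is affine, far enough in
    the decreasing direction. *)
Lemma discriminant_le0 (R : realFieldType) (a b c : R) : 0 <= a -> 0 <= b ->
  (forall s, 0 <= s ^+ 2 * a + s * c *+ 2 + b) -> c ^+ 2 <= a * b.
Proof.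
move=> a0 b0 h; have [az|an0] := eqVneq a 0; last first.
  have {an0} ap : 0 < a by rewrite lt_neqAle eq_sym an0.
  have := h (- c / a).
  have -> : (- c / a) ^+ 2 * a + - c / a * c *+ 2 + b = (a * b - c ^+ 2) / a.
    by field; rewrite gt_eqF.
  by rewrite pmulr_lge0 ?invr_gt0// subr_ge0.
have [->|c0] := eqVneq c 0; first by rewrite expr0n mulr_ge0.
have := h (- (b + 1) / (c *+ 2)); rewrite az mulr0 add0r.
have -> : - (b + 1) / (c *+ 2) * c *+ 2 + b = -1 by field.
by rewrite oppr_ge0 ler10.
Qed.

Section Dot.
Context {R : realType} {p : nat}.
Implicit Types (A B G M N S : 'M[R]_p) (u v w x : 'cV[R]_p) (c : R).

Lemma dotE u v : dot u v = \sum_k u k 0 * v k 0.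
Proof. by rewrite /dot mxE; apply: eq_bigr => k _; rewrite mxE. Qed.

Lemma dotC u v : dot u v = dot v u.
Proof. by rewrite !dotE; apply: eq_bigr => k _; rewrite mulrC. Qed.

Lemma dotDr u v w : dot u (v + w) = dot u v + dot u w.
Proof. by rewrite /dot mulmxDr mxE. Qed.

Lemma dotZr c u v : dot u (c *: v) = c * dot u v.
Proof. by rewrite /dot -scalemxAr mxE. Qed.

Lemma dotDl u v w : dot (v + w) u = dot v u + dot w u.
Proof. by rewrite dotC dotDr !(dotC u). Qed.

Lemma dotZl c u v : dot (c *: v) u = c * dot v u.
Proof. by rewrite dotC dotZr (dotC u). Qed.

Lemma dotNr u v : dot u (- v) = - dot u v.
Proof. by rewrite -scaleN1r dotZr mulN1r. Qed.

Lemma dot0r u : dot u 0 = 0.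
Proof. by rewrite /dot mulmx0 mxE. Qed.

Lemma dot_ge0 v : 0 <= dot v v.
Proof. by rewrite dotE sumr_ge0// => k _; rewrite -expr2 sqr_ge0. Qed.

Lemma dot_eq0 v : dot v v = 0 -> v = 0.
Proof.
rewrite dotE => /eqP; rewrite psumr_eq0; last first.
  by move=> k _; rewrite -expr2 sqr_ge0.
move=> /allP h; apply/matrixP => i j; rewrite mxE (ord1 j); apply/eqP.
by have := h i (mem_index_enum i); rewrite -expr2 sqrf_eq0.
Qed.

Lemma dot_trmx M u v : dot u (M *m v) = dot (M^T *m u) v.
Proof. by rewrite /dot trmx_mul trmxK mulmxA. Qed.

Lemma dot_sym M u v : M^T = M -> dot u (M *m v) = dot (M *m u) v.
Proof. by rewrite dot_trmx => ->. Qed.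

Lemma outer_mul u v w : (u *m v^T) *m w = dot v w *: u.
Proof.
by rewrite -mulmxA [v^T *m w]mx11_scalar mul_mx_scalar.
Qed.

Lemma quad_outer u v w : quad (u *m v^T) w = dot u w * dot v w.
Proof. by rewrite /quad outer_mul dotZr mulrC (dotC w). Qed.

Lemma quadDm M N v : quad (M + N) v = quad M v + quad N v.
Proof. by rewrite /quad mulmxDl dotDr. Qed.

Lemma quadNm M v : quad (- M) v = - quad M v.
Proof. by rewrite /quad mulNmx dotNr. Qed.

Lemma quadZm c M v : quad (c *: M) v = c * quad M v.
Proof. by rewrite /quad -scalemxAl dotZr. Qed.

Lemma quadZv c M v : quad M (c *: v) = c ^+ 2 * quad M v.
Proof. by rewrite /quad -scalemxAr dotZr dotZl mulrA. Qed.

Lemma quad0v M : quad M 0 = 0.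
Proof. by rewrite /quad mulmx0 dot0r. Qed.

Lemma quad1 v : quad 1%:M v = dot v v.
Proof. by rewrite /quad mul1mx. Qed.

Lemma quad_scalar c v : quad c%:M v = c * dot v v.
Proof. by rewrite /quad mul_scalar_mx dotZr. Qed.

Lemma quadD M u v : M^T = M ->
  quad M (u + v) = quad M u + dot u (M *m v) *+ 2 + quad M v.
Proof.
move=> Msym; rewrite /quad mulmxDr dotDl !dotDr (dot_sym v u Msym).
rewrite (dotC (M *m v)); ring.
Qed.

Lemma psd1 : psdmx (1%:M : 'M[R]_p).
Proof. by split=> [|v]; rewrite ?trmx1// quad1 dot_ge0. Qed.

Lemma psdD M N : psdmx M -> psdmx N -> psdmx (M + N).
Proof.
move=> [Ms M0] [Ns N0]; split; first by rewrite linearD /= Ms Ns.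
by move=> v; rewrite quadDm addr_ge0.
Qed.

Lemma psdZ c M : 0 <= c -> psdmx M -> psdmx (c *: M).
Proof.
move=> c0 [Ms M0]; split; first by rewrite linearZ /= Ms.
by move=> v; rewrite quadZm mulr_ge0.
Qed.

Lemma psd_outer v : psdmx (v *m v^T).
Proof.
split; first by rewrite trmx_mul trmxK.
by move=> w; rewrite quad_outer -expr2 sqr_ge0.
Qed.

Lemma psd_sum (I : Type) (r : seq I) (F : I -> 'M[R]_p) :
  (forall i, psdmx (F i)) -> psdmx (\sum_(i <- r) F i).
Proof.
move=> F0; elim/big_ind: _ => //; last exact: psdD.
by split=> [|v]; rewrite ?trmx0// /quad mul0mx dot0r.
Qed.

(** The quadratic [s |-> quad M (s u + v)] is nonnegative. *)
Lemma psd_cauchy_schwarz M u v : psdmx M ->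
  dot u (M *m v) ^+ 2 <= quad M u * quad M v.
Proof.
move=> [Ms M0]; apply: discriminant_le0 => // s.
by rewrite -quadZv -dotZl -quadD.
Qed.

Lemma cauchy_schwarz u v : dot u v ^+ 2 <= dot u u * dot v v.
Proof.
by have := psd_cauchy_schwarz u v psd1; rewrite mul1mx !quad1.
Qed.

Lemma psd_quad_eq0 M v : psdmx M -> quad M v = 0 -> M *m v = 0.
Proof.
move=> M0 v0; apply: dot_eq0.
have := psd_cauchy_schwarz (M *m v) v M0; rewrite v0 mulr0 => h.
by apply/eqP; rewrite -sqrf_eq0 eq_le h sqr_ge0.
Qed.

Lemma psd_quad0_eq0 M : psdmx M -> (forall v, quad M v = 0) -> M = 0.
Proof.
move=> M0 q0; apply/matrixP => i j; rewrite mxE.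
have := psd_quad_eq0 M0 (q0 (delta_mx j 0)); rewrite -colE.
by move=> /matrixP /(_ i 0); rewrite !mxE.
Qed.

Lemma enorm_ge0 v : 0 <= enorm v.
Proof. exact: sqrtr_ge0. Qed.

Lemma sqr_enorm v : enorm v ^+ 2 = dot v v.
Proof. by rewrite /enorm sqr_sqrtr// dot_ge0. Qed.

Lemma enorm_eq0 v : enorm v = 0 -> v = 0.
Proof. by move=> v0; apply: dot_eq0; rewrite -sqr_enorm v0 expr0n. Qed.

Lemma enormZ c v : 0 <= c -> enorm (c *: v) = c * enorm v.
Proof.
move=> c0; rewrite /enorm dotZl dotZr mulrA -expr2 sqrtrM ?sqr_ge0//.
by rewrite sqrtr_sqr ger0_norm.
Qed.

Lemma opnorm_le c M : 0 <= c ->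
  (forall v, dot (M *m v) (M *m v) <= c ^+ 2 * dot v v) -> opnorm M <= c.
Proof.
move=> c0 h; rewrite /opnorm.
(* In dimension zero the unit sphere is empty and the supremum is 0. *)
set E := (X in sup X); have [->|E0] := eqVneq E set0; first by rewrite sup0.
apply: ge_sup; first exact/set0P.
move=> _ [v /= v1 <-]; rewrite -(@ler_pXn2r _ 2) ?nnegrE ?enorm_ge0//.
by rewrite sqr_enorm (le_trans (h v))// -sqr_enorm v1 expr1n mulr1.
Qed.

(** The supremum is an upper bound because the Frobenius norm bounds the set, by
    the Cauchy-Schwarz inequality on each row. *)
Lemma enorm_mul_le M v : enorm (M *m v) <= opnorm M * enorm v.
Proof.
pose C := Num.sqrt (\sum_i dot (row i M)^T (row i M)^T).
have CE : C ^+ 2 = \sum_i dot (row i M)^T (row i M)^T.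
  by rewrite sqr_sqrtr// sumr_ge0// => i _; exact: dot_ge0.
have hub : forall w, enorm w = 1 -> enorm (M *m w) <= C.
  move=> w w1; rewrite -(@ler_pXn2r _ 2) ?nnegrE ?enorm_ge0 ?sqrtr_ge0//.
  rewrite sqr_enorm CE dotE; apply: ler_sum => i _.
  have -> : (M *m w) i 0 = dot (row i M)^T w.
    by rewrite dotE mxE; apply: eq_bigr => k _; rewrite !mxE.
  rewrite -expr2 (le_trans (cauchy_schwarz _ _))// -(sqr_enorm w) w1.
  by rewrite expr1n mulr1.
have [v0|v0] := eqVneq (enorm v) 0.
  by rewrite v0 mulr0 (enorm_eq0 v0) mulmx0 /enorm dot0r sqrtr0.
have {}v0 : 0 < enorm v by rewrite lt_neqAle eq_sym v0 enorm_ge0.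
rewrite -ler_pdivrMr// mulrC -enormZ ?invr_ge0 ?enorm_ge0// scalemxAr.
apply: sup_ubound => /=.
  by exists C => _ [w /= w1 <-]; exact: hub.
exists ((enorm v)^-1 *: v) => //=.
by rewrite enormZ ?invr_ge0 ?enorm_ge0// mulVf// gt_eqF.
Qed.

Lemma opnorm_ge0 M : 0 <= opnorm M.
Proof.
rewrite /opnorm; set E := (X in sup X).
have [->|/set0P [_ [v /= v1 _]]] := eqVneq E set0; first by rewrite sup0.
have := enorm_mul_le M v; rewrite v1 mulr1; apply: le_trans.
exact: enorm_ge0.
Qed.

Lemma quad_le_opnorm M v : quad M v <= opnorm M * dot v v.
Proof.
apply: le_trans (ler_norm _) _.
rewrite -(@ler_pXn2r _ 2) ?nnegrE ?normr_ge0 ?mulr_ge0 ?opnorm_ge0 ?dot_ge0//.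
rewrite real_normK ?num_real// (le_trans (cauchy_schwarz _ _))//.
rewrite -!sqr_enorm.
have -> : (opnorm M * enorm v ^+ 2) ^+ 2 =
  enorm v ^+ 2 * (opnorm M * enorm v) ^+ 2 by ring.
rewrite ler_wpM2l ?sqr_ge0//; apply: lerXn2r; rewrite ?nnegrE ?enorm_ge0//.
  by rewrite mulr_ge0 ?opnorm_ge0 ?enorm_ge0.
exact: enorm_mul_le.
Qed.

End Dot.

(** * Square roots of positive semidefinite matrices *)

Section SquareRoot.
Context {R : realType} {p : nat}.
Implicit Types (A S : 'M[R]_p) (v : 'cV[R]_p).

(** The Rayleigh quotient attains its maximum on the compact unit sphere, and
    [l 1 - A] is then positive semidefinite with a zero in the direction of a
    maximiser. *)
Lemma psd_top_eigenvector A : psdmx A -> A != 0 ->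
  exists l v, [/\ 0 < l, dot v v = 1 & A *m v = l *: v].
Proof.
move=> A0 An0.
have [w wA] : exists w, 0 < quad A w.
  apply: contrapT => /forallNP h; move/eqP: An0; apply.
  apply: (psd_quad0_eq0 A0) => v; apply/eqP; rewrite eq_le A0.2 andbT leNgt.
  exact/negP/h.
have dw : 0 < dot w w.
  rewrite lt_neqAle dot_ge0 andbT eq_sym; apply/eqP => /dot_eq0 w0.
  by rewrite w0 quad0v ltxx in wA.
have contQ (M : 'M[R]_p) : continuous (fun r : 'rV[R]_p => quad M r^T).
  have -> : (fun r : 'rV[R]_p => quad M r^T) =
      (fun r => \sum_k r 0 k * \sum_j M k j * r 0 j).
    apply/funext => r; rewrite /quad dotE; apply: eq_bigr => k _.
    by rewrite !mxE; congr (_ * _); apply: eq_bigr => j _; rewrite !mxE.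
  have cc k : continuous (fun r : 'rV[R]_p => r 0 k) by exact: coord_continuous.
  apply: continuous_big => [|k _]; first exact: add_continuous.
  have lin : continuous (fun r : 'rV[R]_p => \sum_j M k j * r 0 j).
    apply: continuous_big => [|j _ r]; first exact: add_continuous.
    exact: (cvgMl_tmp (cc j r)).
  move=> r; exact: (cvgM (cc k r) (lin r)).
pose sphere := [set r : 'rV[R]_p | quad 1%:M r^T = 1].
have sphere_compact : compact sphere.
  apply: bounded_closed_compact.
    exists 1; split; first exact: num_real.
    move=> y y1 r /= r1; rewrite [leLHS]/Num.norm /= mx_normrE.
    apply: bigmax_le => [|[i j] _ /=]; first by rewrite (le_trans _ (ltW y1)).
    rewrite (le_trans _ (ltW y1))// (ord1 i) -(@ler_pXn2r _ 2) ?nnegrE//.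
    rewrite expr1n real_normK ?num_real// -r1 quad1 dotE (bigD1 j)//= !mxE.
    by rewrite -expr2 lerDl sumr_ge0// => k _; rewrite -expr2 sqr_ge0.
  exact: (continuous_closedP _).1 (contQ 1%:M) _ (@closed_eq R 1).
have sphere0 : sphere !=set0.
  exists (((Num.sqrt (dot w w))^-1 *: w)^T).
  rewrite /sphere /= trmxK quadZv quad1 exprVn sqr_sqrtr ?dot_ge0// mulVf//.
  by rewrite gt_eqF.
have [r /[!inE] r1 rmax] := EVT_max_rV sphere0 sphere_compact
  (continuous_subspaceT (contQ A)).
rewrite /sphere /= quad1 in r1.
pose l := quad A r^T.
have lmax v : quad A v <= l * dot v v.
  have [/dot_eq0 ->|v0] := eqVneq (dot v v) 0.
    by rewrite quad0v dot0r mulr0.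
  have {}v0 : 0 < dot v v by rewrite lt_neqAle eq_sym v0 dot_ge0.
  have := rmax (((Num.sqrt (dot v v))^-1 *: v)^T).
  rewrite trmxK quadZv exprVn sqr_sqrtr ?dot_ge0// inE /sphere /= => h.
  rewrite -ler_pdivrMr// mulrC; apply: h.
  by rewrite trmxK quadZv quad1 exprVn sqr_sqrtr ?dot_ge0// mulVf// gt_eqF.
exists l, r^T; split => //.
  by rewrite -(pmulr_lgt0 _ dw) (lt_le_trans wA).
have psdL : psdmx (l%:M - A).
  split; first by rewrite linearB /= tr_scalar_mx A0.1.
  by move=> v; rewrite quadDm quadNm quad_scalar subr_ge0.
have := @psd_quad_eq0 _ _ _ r^T psdL.
rewrite quadDm quadNm quad_scalar r1 mulr1.
rewrite -/l subrr => /(_ erefl); rewrite mulmxBl mul_scalar_mx => /eqP.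
by rewrite subr_eq0 eq_sym => /eqP.
Qed.

(** Splitting off a top eigenvector lowers the rank; the square root of the
    remainder kills that eigenvector, so the two pieces multiply to zero. *)
Lemma psd_sqrt_exists A : psdmx A -> exists S, psdmx S /\ S *m S = A.
Proof.
have [m] := ubnP (\rank A); elim: m A => // m IH A rA A0.
have [->|An0] := eqVneq A 0.
  exists 0; rewrite mulmx0; split=> //; split=> [|v]; first by rewrite trmx0.
  by rewrite /quad mul0mx dot0r.
have [l [v [l0 v1 Av]]] := psd_top_eigenvector A0 An0.
pose B := A - l *: (v *m v^T).
have Bv : B *m v = 0.
  by rewrite mulmxBl -scalemxAl outer_mul v1 scale1r Av subrr.
have BT : B^T = B.
  by rewrite linearB /= linearZ /= (psd_outer v).1 A0.1.
have vA : v^T *m A = l *: v^T by rewrite -[A]A0.1 -trmx_mul Av linearZ.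
have BE : B = (1%:M - v *m v^T) *m A.
  by rewrite mulmxBl mul1mx -mulmxA vA -scalemxAr.
have psdB : psdmx B.
  split=> // w; have := A0.2 ((1%:M - v *m v^T) *m w).
  suff -> : quad A ((1%:M - v *m v^T) *m w) = quad B w by [].
  have QT : (1%:M - v *m v^T)^T = 1%:M - v *m v^T.
    by rewrite linearB /= (psd_outer v).1 trmx1.
  rewrite /quad -(dot_sym _ _ QT) !mulmxA -BE.
  by rewrite mulmxBr mulmx1 mulmxA Bv mul0mx subr0.
have rB : (\rank B < m)%N.
  rewrite -ltnS; apply: leq_trans rA; rewrite ltnS; apply: rank_ltmx.
  rewrite ltmxE {1}BE submxMl /=; apply/negP => AB.
  have /submxP[D vD] : (v^T <= B)%MS.
    apply: submx_trans AB; apply/submxP; exists (l^-1 *: v^T).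
    by rewrite -scalemxAl vA scalerA mulVf ?gt_eqF// scale1r.
  have := v1; rewrite /dot vD -mulmxA Bv mulmx0 mxE => /eqP.
  by rewrite eq_sym oner_eq0.
have [S [S0 SB]] := IH _ rB psdB.
have Sv : S *m v = 0.
  by apply: dot_eq0; rewrite -dot_sym ?S0.1// mulmxA SB Bv dot0r.
have vS : v^T *m S = 0 by rewrite -[S]S0.1 -trmx_mul Sv trmx0.
exists (S + Num.sqrt l *: (v *m v^T)); split.
  by apply: psdD => //; apply: psdZ (psd_outer v); exact: sqrtr_ge0.
have ES : (v *m v^T) *m S = 0 by rewrite -mulmxA vS mulmx0.
have SE : S *m (v *m v^T) = 0 by rewrite mulmxA Sv mul0mx.
have EE : (v *m v^T) *m (v *m v^T) = v *m v^T.
  by rewrite mulmxA outer_mul v1 scale1r.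
rewrite mulmxDr !mulmxDl SB -!scalemxAl -!scalemxAr ES SE EE !scaler0.
by rewrite addr0 add0r scalerA -expr2 sqr_sqrtr ?ltW// subrK.
Qed.

End SquareRoot.

(** * Resolvents *)

Section Resolvent.
Context {R : realType} {p : nat}.
Implicit Types (A B G M N S : 'M[R]_p) (u v w x z : 'cV[R]_p) (c t b : R).

Lemma posdef_psd A : posdefmx A -> psdmx A.
Proof.
move=> [As A0]; split=> // v; have [->|v0] := eqVneq v 0.
  by rewrite quad0v.
exact/ltW/A0.
Qed.

Lemma posdef_unitmx A : posdefmx A -> A \in unitmx.
Proof.
move=> [As A0]; rewrite -row_free_unit -kermx_eq0; apply/eqP/row_matrixP => i.
rewrite row0; apply: contrapT => /eqP k0.
have kA : row i (kermx A) *m A = 0 by rewrite -row_mul mulmx_ker row0.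
have Ak : A *m (row i (kermx A))^T = 0 by rewrite -{1}[A]As -trmx_mul kA trmx0.
have : (row i (kermx A))^T != 0.
  by apply: contra k0 => /eqP h; rewrite -[row _ _]trmxK h trmx0.
by move/A0; rewrite /quad Ak dot0r ltxx.
Qed.

Lemma posdef_loewner A B : posdefmx A -> loewner_le A B -> posdefmx B.
Proof.
move=> [As A0] [Ds D0]; split.
  by move: Ds; rewrite linearB /= As => /(congr1 (+%R^~ A)); rewrite !subrK.
move=> v v0; rewrite -(subrK A B) quadDm; apply: ltr_wpDl (A0 _ v0).
exact: D0.
Qed.

Lemma loewner_quad A B v : loewner_le A B -> quad A v <= quad B v.
Proof. by move=> [_ /(_ v)]; rewrite quadDm quadNm subr_ge0. Qed.

Lemma invmx_sym A : A^T = A -> (invmx A)^T = invmx A.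
Proof. by move=> As; rewrite trmx_inv As. Qed.

Lemma quad_invmx A v : posdefmx A -> quad A (invmx A *m v) = quad (invmx A) v.
Proof.
by move=> A0; rewrite /quad mulKVmx ?posdef_unitmx// dotC.
Qed.

Lemma psd_invmx A : posdefmx A -> psdmx (invmx A).
Proof.
move=> A0; split; first by rewrite invmx_sym// A0.1.
by move=> v; rewrite -quad_invmx// (posdef_psd A0).2.
Qed.

(** The operator norm bound for [A^(-1/2) S A^(-1/2)], read at the vector
    [A^(1/2) v]. *)
Lemma quad_le_b_eps A S v : posdefmx A -> quad S v <= b_eps A S * quad A v.
Proof.
move=> A0.
have [[Qs Q0] QA] : psdmx (sqrtmx A) /\ sqrtmx A *m sqrtmx A = A.
  exact: (xgetPex 0 (psd_sqrt_exists (posdef_psd A0))).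
have Qu : sqrtmx A \in unitmx.
  by have := posdef_unitmx A0; rewrite -[A in A \in _]QA unitmx_mul andbb.
have := quad_le_opnorm (invsqrtmx A *m S *m invsqrtmx A) (sqrtmx A *m v).
have -> : dot (sqrtmx A *m v) (sqrtmx A *m v) = quad A v.
  by rewrite -dot_sym// mulmxA QA.
suff -> : quad (invsqrtmx A *m S *m invsqrtmx A) (sqrtmx A *m v) =
  quad S v by [].
rewrite /quad -!mulmxA -dot_sym//.
by rewrite /invsqrtmx mulKVmx// mulKmx.
Qed.

Lemma b_eps_ge0 A S : 0 <= b_eps A S.
Proof. exact: opnorm_ge0. Qed.

(** Expand [0 <= quad A (A^-1 x - M^-1 x)] and bound the last term by
    [quad M (M^-1 x) = quad (M^-1) x]. *)
Lemma quad_invmx_anti A M x : posdefmx A -> loewner_le A M ->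
  quad (invmx M) x <= quad (invmx A) x.
Proof.
move=> A0 AM; have M0 := posdef_loewner A0 AM.
have := (posdef_psd A0).2 (invmx A *m x + - (invmx M *m x)).
rewrite quadD ?A0.1// quad_invmx// -scaleN1r quadZv sqrrN expr1n mul1r.
rewrite dot_sym ?A0.1// mulKVmx ?posdef_unitmx// dotZr -/(quad (invmx M) x).
have := loewner_quad (invmx M *m x) AM; rewrite [quad M _]quad_invmx//.
lra.
Qed.

Section Bounds.
Variables (M S : 'M[R]_p) (t b : R).
Hypotheses (M0 : posdefmx M) (S0 : psdmx S) (t0 : 0 < t).
Hypothesis tM : forall v, t * dot v v <= quad M v.
Hypothesis SbM : forall v, quad S v <= b * quad M v.
Let G := invmx M.

Lemma resolvent_sqr_le x : t * dot (G *m x) (G *m x) <= quad G x.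
Proof. by rewrite -quad_invmx//; exact: tM. Qed.

(** By Cauchy-Schwarz [(x' G x)^2 <= |x|^2 |G x|^2], and the last factor is
    controlled by [x' G x] itself. *)
Lemma quad_resolvent_le x : t * quad G x <= dot x x.
Proof.
have G0 := psd_invmx M0.
have [->|q0] := eqVneq (quad G x) 0; first by rewrite mulr0 dot_ge0.
have {}q0 : 0 < quad G x by rewrite lt_neqAle eq_sym q0 G0.2.
rewrite -(ler_pM2r q0) -mulrA -expr2.
have h : t * quad G x ^+ 2 <= t * (dot x x * dot (G *m x) (G *m x)).
  by rewrite ler_pM2l//; exact: cauchy_schwarz.
rewrite (le_trans h)// mulrCA ler_wpM2l ?dot_ge0//.
exact: resolvent_sqr_le.
Qed.

Lemma sandwich_quad_le x : quad (G *m S *m G) x <= b * quad G x.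
Proof.
rewrite -quad_invmx// (le_trans _ (SbM _))//.
by rewrite /quad -!mulmxA dot_sym// invmx_sym// M0.1.
Qed.

Lemma psd_sandwich : psdmx (G *m S *m G).
Proof.
have Gs : G^T = G by rewrite invmx_sym// M0.1.
split; first by rewrite !trmx_mul Gs S0.1 mulmxA.
by move=> v; rewrite /quad -!mulmxA dot_sym// S0.2.
Qed.

(** With [v = G S G x], [t |v|^2 <= v' M v = v' S G x], and the Cauchy-Schwarz
    inequality for [S <= b M] bounds the right-hand side by itself. *)
Lemma sandwich_sqr_le x :
  t * dot (G *m S *m G *m x) (G *m S *m G *m x) <= b ^+ 2 * quad G x.
Proof.
set v := G *m S *m G *m x; apply: le_trans (tM v) _.
have vE : quad M v = dot v (S *m (G *m x)).
  by rewrite /quad {2}/v -!mulmxA mulKVmx// posdef_unitmx.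
have SG : quad S (G *m x) <= b * quad G x by rewrite -quad_invmx//; exact: SbM.
have G0 := (psd_invmx M0).2 x.
have [v0|v0] := eqVneq (quad M v) 0.
  by rewrite v0 mulr_ge0 ?sqr_ge0.
have {}v0 : 0 < quad M v by rewrite lt_neqAle eq_sym v0 (posdef_psd M0).2.
rewrite -(ler_pM2r v0) -expr2 {1}vE (le_trans (psd_cauchy_schwarz _ _ S0))//.
rewrite [leRHS](_ : _ = b * quad M v * (b * quad G x)); last by ring.
by apply: ler_pM => //; exact: S0.2.
Qed.

Lemma resolvent_dot_le x : dot (G *m x) (G *m x) <= t^-1 ^+ 2 * dot x x.
Proof.
rewrite -(ler_pM2l t0) (le_trans (resolvent_sqr_le x))//.
rewrite -(ler_pM2l t0) (le_trans (quad_resolvent_le x))//.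
rewrite [leRHS](_ : _ = dot x x)//.
by field; rewrite gt_eqF.
Qed.

Lemma sandwich_dot_le x :
  dot (G *m S *m G *m x) (G *m S *m G *m x) <= (b / t) ^+ 2 * dot x x.
Proof.
rewrite -(ler_pM2l t0) (le_trans (sandwich_sqr_le x))//.
rewrite -(ler_pM2l t0) [leLHS]mulrCA.
rewrite (le_trans (ler_wpM2l (sqr_ge0 b) (quad_resolvent_le x)))//.
rewrite [leRHS](_ : _ = b ^+ 2 * dot x x)//.
by field; rewrite gt_eqF.
Qed.

End Bounds.

(** The Sherman-Morrison formula: [M + a z z'] maps the right-hand side to
    [x]. *)
Lemma resolvent_rank1 M a z x : posdefmx M -> 0 <= a ->
  let G := invmx M in
  invmx (M + a *: (z *m z^T)) *m x =
  G *m x - (a * dot z (G *m x) / (1 + a * quad G z)) *: (G *m z).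
Proof.
move=> M0 a0 G.
have Mu := posdef_unitmx M0.
have M1 : posdefmx (M + a *: (z *m z^T)).
  apply: posdef_loewner M0 _; rewrite /loewner_le addrC addKr.
  exact: psdZ (psd_outer z).
set c := _ / _.
have q0 : 1 + a * quad G z != 0.
  by rewrite gt_eqF// ltr_wpDr// mulr_ge0// (psd_invmx M0).2.
suff {1}<- : (M + a *: (z *m z^T)) *m (G *m x - c *: (G *m z)) = x.
  by rewrite mulmxA mulVmx ?posdef_unitmx// mul1mx.
rewrite mulmxDl mulmxBr -!scalemxAr -scalemxAl !mulKVmx// outer_mul dotDr.
rewrite dotNr dotZr scalerA -/(quad G z) -addrA -scaleNr -scalerDl.
rewrite (_ : - c + _ = 0) ?scale0r ?addr0// /c.
by field.
Qed.

End Resolvent.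

(** * Scalar estimates for a rank-one perturbation *)

Section ScalarEstimates.
Context {R : realType}.

Lemma normM_le_sqrD (x y : R) : `|x * y| <= x ^+ 2 + y ^+ 2.
Proof.
rewrite normrM -[x ^+ 2]real_normK ?num_real// -[y ^+ 2]real_normK ?num_real//.
have := sqr_ge0 (`|x| - `|y|); have := sqr_ge0 `|x|; have := sqr_ge0 `|y|; nra.
Qed.

Implicit Types a b l m q k : R.

(** The change of [x' M^-1 S M^-1 x] when [a z z'] is added to [M]. In terms of
    [G = M^-1], the arguments stand for [l = z' G x], [m = z' G S G x],
    [q = z' G z] and [k = z' G S G z]. *)
Definition rank1_change a l m q k : R :=
  (a * l) ^+ 2 * k / (1 + a * q) ^+ 2 - 2 * a * (l * m) / (1 + a * q).

(** The denominator absorbs the factor [a k <= b (a q)] of the quadratic term,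
    which leaves only the linear forms [l] and [m]. *)
Lemma norm_rank1_change a b l m q k : 0 <= a -> 0 <= b -> 0 <= q ->
  0 <= k <= b * q ->
  `|rank1_change a l m q k| <= 2 * a * `|l * m| + a * b * l ^+ 2.
Proof.
move=> a0 b0 q0 /andP[k0 kq].
have aq : 0 <= a * q by exact: mulr_ge0.
set D := 1 + a * q; have D1 : 1 <= D by rewrite lerDl.
have D0 : 0 < D by lra.
rewrite /rank1_change -/D addrC (le_trans (ler_normD _ _))// lerD//.
  rewrite normrN normrM normfV (ger0_norm (ltW D0)) normrM.
  rewrite ger0_norm ?mulr_ge0// ler_pdivrMr// ler_peMr// !mulr_ge0//.
rewrite ger0_norm; last by rewrite divr_ge0 ?sqr_ge0// mulr_ge0 ?sqr_ge0.
rewrite ler_pdivrMr ?exprn_gt0//.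
have h1 : a * k <= b * D ^+ 2.
  apply: (@le_trans _ _ (b * (a * q))); first by rewrite mulrCA ler_wpM2l.
  by rewrite ler_wpM2l// /D; nra.
have -> : (a * l) ^+ 2 * k = a * l ^+ 2 * (a * k) by ring.
have -> : a * b * l ^+ 2 * D ^+ 2 = a * l ^+ 2 * (b * D ^+ 2) by ring.
by rewrite ler_wpM2l// mulr_ge0// sqr_ge0.
Qed.

(** Comparing [1 / (1 + a q)] with [1 / (1 + a q')] brings out a factor
    [a (q - q')]. In the quadratic term this factor multiplies [a k' <= b (a q')],
    which [1 + a q'] absorbs. *)
Lemma rank1_change_lipschitz a b l m q k q' k' : 0 <= a -> 0 <= b -> 0 <= q ->
  0 <= q' -> 0 <= k' <= b * q' ->
  `|rank1_change a l m q k - rank1_change a l m q' k'| <=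
  2 * a ^+ 2 * `|l * m * (q - q')| +
  a ^+ 2 * (`|l ^+ 2 * (k - k')| + 2 * b * `|l ^+ 2 * (q - q')|).
Proof.
move=> a0 b0 q0 q'0 /andP[k'0 k'q'].
have aq : 0 <= a * q by exact: mulr_ge0.
have aq' : 0 <= a * q' by exact: mulr_ge0.
rewrite /rank1_change.
set D := 1 + a * q; set D' := 1 + a * q'.
have D1 : 1 <= D by rewrite lerDl.
have D0 : 0 < D by lra.
have D'1 : 1 <= D' by rewrite lerDl.
have D'0 : 0 < D' by lra.
have -> : (a * l) ^+ 2 * k / D ^+ 2 - 2 * a * (l * m) / D -
    ((a * l) ^+ 2 * k' / D' ^+ 2 - 2 * a * (l * m) / D') =
    2 * a ^+ 2 * (l * m * (q - q')) / (D * D') +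
    a ^+ 2 * (l ^+ 2 * (k - k') / D ^+ 2 -
      l ^+ 2 * (q - q') * ((a * k') / D' * ((D + D') / (D * D')) / D)).
  rewrite /D /D'; field; rewrite -/D -/D'.
  by rewrite !gt_eqF.
rewrite (le_trans (ler_normD _ _))// lerD//.
  have DD : 0 < D * D' by exact: mulr_gt0.
  rewrite normrM normfV (ger0_norm (ltW DD)) ler_pdivrMr// normrM ger0_norm.
    rewrite ler_peMr//; first by rewrite mulr_ge0// mulr_ge0// sqr_ge0.
    by rewrite (le_trans D1)// ler_peMr// ltW.
  by rewrite mulr_ge0// sqr_ge0.
rewrite normrM ger0_norm ?sqr_ge0// ler_wpM2l ?sqr_ge0//.
rewrite (le_trans (ler_normB _ _))// lerD//.
  rewrite normrM normfV (ger0_norm (sqr_ge0 D)) ler_pdivrMr ?exprn_gt0//.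
  by rewrite ler_peMr// expr_ge1// ltW.
rewrite normrM mulrC ler_wpM2r// ger0_norm; last first.
  apply: divr_ge0 (ltW D0); apply: mulr_ge0; apply: divr_ge0;
  by rewrite ?mulr_ge0 ?addr_ge0 ?mulr_ge0 ?(ltW D0) ?(ltW D'0).
have h1 : a * k' / D' <= b.
  rewrite ler_pdivrMr//; apply: (@le_trans _ _ (b * (a * q'))).
    by rewrite mulrCA ler_wpM2l.
  by rewrite ler_wpM2l// lerDr.
have h2 : (D + D') / (D * D') <= 2.
  by rewrite ler_pdivrMr ?mulr_gt0//; nra.
rewrite ler_pdivrMr//; apply: (@le_trans _ _ (b * 2)).
  apply: ler_pM => //; first by rewrite divr_ge0 ?mulr_ge0// ltW.
  by rewrite divr_ge0 ?addr_ge0 ?mulr_ge0 ?(ltW D0) ?(ltW D'0).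
by rewrite mulrC ler_peMr// mulr_ge0.
Qed.

End ScalarEstimates.

(** * Expectations of real functions *)

Section Expectation.
Context {d : measure_display} {T : measurableType d} {R : realType}.
Variable P : probability T R.
Implicit Types f g : T -> R.

Local Notation E f := (Rintegral P setT f).
Local Notation integ f := (P.-integrable setT (EFin \o f)).
Local Notation meas f := (measurable_fun setT f).

Lemma integ_dom f g : meas f -> (forall w, `|f w| <= g w) -> integ g -> integ f.
Proof.
move=> mf fg ig; apply: (le_integrable measurableT _ _ ig) => /=.
  exact/measurable_EFinP.
by move=> w _ /=; rewrite lee_fin (le_trans (fg w))// ler_norm.
Qed.

Lemma integ_cst c : integ (fun _ => c).
Proof. exact: finite_measure_integrable_cst. Qed.

Lemma integD f g : integ f -> integ g -> integ (fun w => f w + g w).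
Proof. by move=> fi gi; exact: (integrableD measurableT fi gi). Qed.

Lemma integB f g : integ f -> integ g -> integ (fun w => f w - g w).
Proof. by move=> fi gi; exact: (integrableB measurableT fi gi). Qed.

Lemma integZ c f : integ f -> integ (fun w => c * f w).
Proof. by move=> fi; exact: (integrableZl measurableT c fi). Qed.

Lemma integ_sum (I : Type) (r : seq I) (F : I -> T -> R) :
  (forall i, integ (F i)) -> integ (fun w => \sum_(i <- r) F i w).
Proof.
move=> Fi; elim: r => [|i r IH].
  by under [X in EFin \o X]eq_fun do rewrite big_nil; exact: integ_cst.
by under [X in EFin \o X]eq_fun do rewrite big_cons; exact: integD.
Qed.

Lemma E_cst c : E (fun _ => c) = c.
Proof. by rewrite Rintegral_cst// [X in fine X]probability_setT mulr1. Qed.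

Lemma E_sum (I : Type) (r : seq I) (F : I -> T -> R) :
  (forall i, integ (F i)) ->
  E (fun w => \sum_(i <- r) F i w) = \sum_(i <- r) E (F i).
Proof.
move=> Fi; elim: r => [|i r IH].
  rewrite big_nil -[RHS](E_cst 0); apply: eq_Rintegral => w _.
  by rewrite big_nil.
rewrite big_cons -IH -RintegralD//; last exact: integ_sum.
by apply: eq_Rintegral => w _; rewrite big_cons.
Qed.

Lemma E_le f g : integ f -> integ g -> (forall w, f w <= g w) -> E f <= E g.
Proof. by move=> fi gi fg; exact: le_Rintegral. Qed.

Lemma E_abs_le f g : integ f -> integ g -> (forall w, `|f w| <= g w) ->
  `|E f| <= E g.
Proof.
move=> fi gi fg; apply: le_trans (le_normr_Rintegral measurableT fi) _.
exact: E_le (integrable_norm fi) gi fg.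
Qed.

(** The discriminant of [s |-> E (s |f| + |g|)^2]. *)
Lemma E_cauchy_schwarz f g (a b : R) : meas f -> meas g ->
  integ (fun w => f w ^+ 2) -> integ (fun w => g w ^+ 2) ->
  0 <= a -> 0 <= b -> E (fun w => f w ^+ 2) <= a ^+ 2 ->
  E (fun w => g w ^+ 2) <= b ^+ 2 ->
  integ (fun w => f w * g w) /\ E (fun w => `|f w * g w|) <= a * b.
Proof.
move=> mf mg if2 ig2 a0 b0 fa gb.
have ifg : integ (fun w => f w * g w).
  apply: (integ_dom _ _ (integD if2 ig2)); first exact: measurable_funM.
  by move=> w; exact: normM_le_sqrD.
split=> //.
have h : E (fun w => `|f w * g w|) ^+ 2 <=
    E (fun w => f w ^+ 2) * E (fun w => g w ^+ 2).
  apply: discriminant_le0; try by apply: Rintegral_ge0 => w _; exact: sqr_ge0.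
  move=> s; have ia := integrable_norm ifg.
  rewrite -mulrnAl -mulr_natl.
  have -> : s ^+ 2 * E (fun w => f w ^+ 2) + 2%:R * s * E (fun w => `|f w * g w|)
      + E (fun w => g w ^+ 2) =
      E (fun w => s ^+ 2 * f w ^+ 2 + 2%:R * s * `|f w * g w| + g w ^+ 2).
    rewrite !RintegralD// ?RintegralZl//; try exact: integZ.
    by apply: integD; exact: integZ.
  apply: Rintegral_ge0 => w _; rewrite normrM.
  rewrite -[f w ^+ 2]real_normK ?num_real// -[g w ^+ 2]real_normK ?num_real//.
  rewrite (_ : _ + _ = (s * `|f w| + `|g w|) ^+ 2) ?sqr_ge0//; ring.
rewrite -(@ler_pXn2r _ 2) ?nnegrE ?mulr_ge0 ?Rintegral_ge0//.
rewrite (le_trans h)// exprMn; apply: ler_pM => //;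
  by apply: Rintegral_ge0 => w _; exact: sqr_ge0.
Qed.

(** A finite bound on an extended-real expectation of a nonnegative function
    gives integrability, after which real-valued integrals suffice. *)
Lemma E_of_expectation f (c : \bar R) : meas f -> (forall w, 0 <= f w) ->
  c \is a fin_num -> ('E_P[f] <= c)%E -> integ f /\ E f <= fine c.
Proof.
move=> mf f0 cf; rewrite unlock => fc.
have fi : integ f.
  apply/integrableP; split; first exact/measurable_EFinP.
  rewrite (eq_integral (EFin \o f)); last first.
    by move=> w _ /=; rewrite ger0_norm.
  by rewrite (le_lt_trans fc)// ltey_eq cf.
by split=> //; rewrite fine_le// integrable_fin_num.
Qed.

End Expectation.

(** * Measurability of matrix-valued functions *)

Section MatrixMeasurability.
Context {d : measure_display} {T : measurableType d} {R : realType}.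

Definition mx_measurable m n (Z : T -> 'M[R]_(m, n)) :=
  forall i j, measurable_fun setT (fun w => Z w i j).

Lemma eq_mx_measurable m n (Z W : T -> 'M[R]_(m, n)) : Z =1 W ->
  mx_measurable W -> mx_measurable Z.
Proof. by move=> /funext ->. Qed.

Lemma mx_measurable_cst m n (M : 'M[R]_(m, n)) : mx_measurable (fun _ => M).
Proof. by move=> i j; exact: measurable_cst. Qed.

Lemma mx_measurableD m n (Z W : T -> 'M[R]_(m, n)) :
  mx_measurable Z -> mx_measurable W -> mx_measurable (fun w => Z w + W w).
Proof.
move=> mZ mW i j; under eq_fun do rewrite mxE.
exact: measurable_funD.
Qed.

Lemma mx_measurableZ m n (f : T -> R) (Z : T -> 'M[R]_(m, n)) :
  measurable_fun setT f ->
  mx_measurable Z -> mx_measurable (fun w => f w *: Z w).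
Proof.
move=> mf mZ i j; under eq_fun do rewrite mxE.
exact: measurable_funM.
Qed.

Lemma mx_measurable_sum m n (I : Type) (r : seq I) (Z : I -> T -> 'M[R]_(m, n)) :
  (forall i, mx_measurable (Z i)) -> mx_measurable (fun w => \sum_(i <- r) Z i w).
Proof.
move=> mZ i j; under eq_fun do rewrite summxE.
by apply: measurable_sum => k; exact: mZ.
Qed.

Lemma mx_measurableM m n k (Z : T -> 'M[R]_(m, n)) (W : T -> 'M[R]_(n, k)) :
  mx_measurable Z -> mx_measurable W -> mx_measurable (fun w => Z w *m W w).
Proof.
move=> mZ mW i j; under eq_fun do rewrite mxE.
by apply: measurable_sum => l; exact: measurable_funM.
Qed.

Lemma mx_measurable_tr m n (Z : T -> 'M[R]_(m, n)) :
  mx_measurable Z -> mx_measurable (fun w => (Z w)^T).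
Proof. by move=> mZ i j; under eq_fun do rewrite mxE; exact: mZ. Qed.

Lemma measurable_det n (Z : T -> 'M[R]_n) :
  mx_measurable Z -> measurable_fun setT (fun w => \det (Z w)).
Proof.
move=> mZ; apply: measurable_sum => s; apply: measurable_funM.
  exact: measurable_cst.
by apply: measurable_prod => i _; exact: mZ.
Qed.

Lemma measurable_inv_ge0 (f : T -> R) : measurable_fun setT f ->
  (forall w, 0 <= f w) -> measurable_fun setT (fun w => (f w)^-1).
Proof.
move=> mf f0; under eq_fun do rewrite -powR_inv1//.
exact: (measurableT_comp (measurable_powR (-1)) mf).
Qed.

(** Cramer's rule. The reciprocal of the determinant is written
    [det / det^2], so that only a nonnegative function gets inverted. *)
Lemma mx_measurable_invmx n (Z : T -> 'M[R]_n) :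
  mx_measurable Z -> (forall w, Z w \in unitmx) ->
  mx_measurable (fun w => invmx (Z w)).
Proof.
move=> mZ uZ.
have mdet := measurable_det mZ.
have -> : (fun w => invmx (Z w)) =
    (fun w => (\det (Z w) * (\det (Z w) ^+ 2)^-1) *: \adj (Z w)).
  apply/funext => w; rewrite /invmx uZ; congr (_ *: _).
  have := uZ w; rewrite unitmxE unitfE => d0; field.
  by [].
apply: mx_measurableZ.
  apply: measurable_funM => //; apply: measurable_inv_ge0.
    exact: measurable_funX.
  by move=> w; exact: sqr_ge0.
move=> i j; under eq_fun do rewrite mxE /cofactor.
apply: measurable_funM; first exact: measurable_cst.
apply: measurable_det => k l; under eq_fun do rewrite !mxE.
exact: mZ.
Qed.

Lemma random_vector_measurable p (Z : T -> 'cV[R]_p) :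
  random_vector Z -> mx_measurable Z.
Proof.
move=> mZ i j; rewrite (ord1 j).
apply: (measurability _ (RGenOInfty.measurableE R)).
move=> _ [_ [x ->] <-]; rewrite setTI.
rewrite (_ : _ @^-1` _ = Z @^-1` [set v | x < v i 0]); last first.
  by apply/seteqP; split=> w /=; rewrite in_itv/= andbT.
apply: mZ.
apply: sub_sigma_algebra => /=.
have cc : continuous (fun v : 'cV[R]_p => v i 0) by exact: coord_continuous.
exact: (continuousP _).1 cc _ (@open_gt R x).
Qed.

Lemma measurable_dot p (Z W : T -> 'cV[R]_p) :
  mx_measurable Z -> mx_measurable W -> measurable_fun setT (fun w => dot (Z w) (W w)).
Proof. by move=> mZ mW; exact: (mx_measurableM (mx_measurable_tr mZ) mW). Qed.

Lemma measurable_quad p (M : T -> 'M[R]_p) (Z : T -> 'cV[R]_p) :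
  mx_measurable M -> mx_measurable Z -> measurable_fun setT (fun w => quad (M w) (Z w)).
Proof. by move=> mM mZ; apply: measurable_dot => //; exact: mx_measurableM. Qed.

End MatrixMeasurability.

(** * One random vector with controlled moments *)

Section RandomVector.
Context {d : measure_display} {T : measurableType d} {R : realType}.
Variables (P : probability T R) (p : nat).
Variables (Z : T -> 'cV[R]_p) (Sigma : 'M[R]_p) (bL bQ : nat -> \bar R).
Hypotheses (p_gt0 : (0 < p)%N) (rZ : random_vector Z) (Z0 : has_mean0 P Z).
Hypotheses (ZSigma : has_covmx P Z Sigma) (bZ : moment_controls P Z bL bQ).

Local Notation E f := (Rintegral P setT f).
Local Notation integ f := (P.-integrable setT (EFin \o f)).
Local Notation meas f := (measurable_fun setT f).
Implicit Types (u v : 'cV[R]_p) (M : 'M[R]_p).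

Let mZ : mx_measurable Z. Proof. exact: random_vector_measurable. Qed.

Lemma meas_dotZ u : meas (fun w => dot (Z w) u).
Proof. by apply: measurable_dot => //; exact: mx_measurable_cst. Qed.

Lemma meas_quadZ M : meas (fun w => quad M (Z w)).
Proof. by apply: measurable_quad => //; exact: mx_measurable_cst. Qed.

Lemma linear_moment u (c : R) k : (0 < k)%N -> bL k.*2%N \is a fin_num ->
  dot u u <= c -> integ (fun w => dot (Z w) u ^+ k.*2) /\
  E (fun w => dot (Z w) u ^+ k.*2) <= c ^+ k * fine (bL k.*2).
Proof.
move=> k0 bk uc; have c0 : 0 <= c by exact: le_trans (dot_ge0 u) uc.
have [lZ _ _ _] := bZ.
have ev (x : R) : `|x| ^+ k.*2 = x ^+ k.*2.
  by rewrite -mul2n !exprM real_normK ?num_real.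
have key v : enorm v = 1 -> integ (fun w => dot (Z w) v ^+ k.*2) /\
    E (fun w => dot (Z w) v ^+ k.*2) <= fine (bL k.*2).
  move=> v1; apply: E_of_expectation => //.
  - by apply: measurable_funX; exact: meas_dotZ.
  - by move=> w; rewrite -ev exprn_ge0.
  - have := lZ k.*2; rewrite double_gt0 => /(_ k0 v v1).
    by congr ('E_P[_] <= _)%E; apply/funext => w; exact: ev.
have [u0|u0] := eqVneq u 0.
  have -> : (fun w => dot (Z w) u ^+ k.*2) = (fun _ => 0).
    by apply/funext => w; rewrite u0 dot0r expr0n double_eq0 -leqn0 leqNgt k0.
  split; first exact: integ_cst.
  rewrite E_cst mulr_ge0 ?exprn_ge0//.
  (* Here the claim is that [bL (2 k)] is nonnegative, which follows from the
     moment bound for any unit vector. *)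
  have e1 : enorm (delta_mx (Ordinal p_gt0) 0 : 'cV[R]_p) = 1.
    rewrite /enorm dotE (bigD1 (Ordinal p_gt0))//= big1 => [|j /negPf j0].
      by rewrite mxE !eqxx mulr1 addr0 sqrtr1.
    by rewrite mxE j0 mul0r.
  apply: le_trans (key _ e1).2; apply: Rintegral_ge0 => w _.
  by rewrite -ev exprn_ge0.
have e0 : enorm u != 0 by apply: contra u0 => /eqP /enorm_eq0 ->.
have ep : 0 < enorm u by rewrite lt_neqAle eq_sym e0 enorm_ge0.
pose v := (enorm u)^-1 *: u.
have v1 : enorm v = 1 by rewrite enormZ ?invr_ge0 ?ltW// mulVf.
have uv w : dot (Z w) u ^+ k.*2 = dot u u ^+ k * dot (Z w) v ^+ k.*2.
  rewrite -sqr_enorm -exprM mul2n -exprMn -dotZr /v scalerA mulfV//.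
  by rewrite scale1r.
have [iv Ev] := key v v1; under eq_fun do rewrite uv.
split; first exact: integZ.
rewrite RintegralZl//; apply: ler_pM => //.
- by rewrite exprn_ge0// dot_ge0.
- by apply: Rintegral_ge0 => w _; rewrite -ev exprn_ge0.
- by apply: lerXn2r; rewrite ?nnegrE ?dot_ge0.
Qed.

Lemma linear_moment2 u c : dot u u <= c -> integ (fun w => dot (Z w) u ^+ 2) /\
  E (fun w => dot (Z w) u ^+ 2) <= c * fine (bL 2%N).
Proof.
have [_ _ [b2 _ _] _] := bZ => uc.
by have := @linear_moment u c 1 erefl b2 uc; rewrite expr1.
Qed.

Lemma linear_moment4 u c : dot u u <= c -> integ (fun w => dot (Z w) u ^+ 4) /\
  E (fun w => dot (Z w) u ^+ 4) <= c ^+ 2 * fine (bL 4%N).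
Proof.
by have [_ _ [_ b4 _] _] := bZ => uc; exact: (@linear_moment u c 2).
Qed.

Lemma bL2_ge0 : 0 <= fine (bL 2%N).
Proof.
have /linear_moment2[_] : dot (0 : 'cV[R]_p) 0 <= 1 by rewrite dot0r.
rewrite mul1r; apply: le_trans; apply: Rintegral_ge0 => w _; exact: sqr_ge0.
Qed.

Lemma bL4_ge0 : 0 <= fine (bL 4%N).
Proof.
have /linear_moment4[_] : dot (0 : 'cV[R]_p) 0 <= 1 by rewrite dot0r.
rewrite expr1n mul1r; apply: le_trans; apply: Rintegral_ge0 => w _.
by rewrite (exprM _ 2 2) sqr_ge0.
Qed.

Lemma linear_prod_integ u v : integ (fun w => dot (Z w) u * dot (Z w) v).
Proof.
have [iu Eu] := linear_moment2 (lexx (dot u u)).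
have [iv Ev] := linear_moment2 (lexx (dot v v)).
apply: (integ_dom _ _ (integD iu iv)).
  by apply: measurable_funM; exact: meas_dotZ.
by move=> w; exact: normM_le_sqrD.
Qed.

Lemma E_coord_prod k l : integ (fun w => Z w k 0 * Z w l 0) /\
  E (fun w => Z w k 0 * Z w l 0) = Sigma k l.
Proof.
have dotdelta j w : dot (Z w) (delta_mx j 0) = Z w j 0.
  rewrite dotE (bigD1 j)//= big1 => [|i /negPf ij]; last by rewrite mxE ij mulr0.
  by rewrite mxE !eqxx mulr1 addr0.
split.
  have := linear_prod_integ (delta_mx k 0) (delta_mx l 0).
  by congr integrable; apply/funext => w /=; rewrite !dotdelta.
have := ZSigma k l; rewrite unlock !Z0 /= unlock => h.
rewrite /Rintegral -[RHS]/(fine (Sigma k l)%:E) -h; congr fine.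
apply: eq_integral => w _.
congr EFin; transitivity ((Z w k 0 - 0) * (Z w l 0 - 0)); last by [].
by rewrite !subr0.
Qed.

(** The trace [tr (C D^T)]. *)
Definition mxpairing (C D : 'M[R]_p) : R := \sum_k \sum_l C k l * D k l.

(** First moments of quadratic forms depend on the law only through the
    covariance matrix, so they agree for any two vectors that share it. *)
Lemma E_quad M : integ (fun w => quad M (Z w)) /\
  E (fun w => quad M (Z w)) = mxpairing M Sigma.
Proof.
have qE : (fun w => quad M (Z w)) =
    fun w => \sum_k \sum_l M k l * (Z w k 0 * Z w l 0).
  apply/funext => w; rewrite /quad dotE; apply: eq_bigr => k _.
  by rewrite mxE mulr_sumr; apply: eq_bigr => l _; rewrite mulrCA.
have ikl k l : integ (fun w => M k l * (Z w k 0 * Z w l 0)).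
  by apply: integZ; exact: (E_coord_prod k l).1.
have ik k : integ (fun w => \sum_l M k l * (Z w k 0 * Z w l 0)).
  exact: integ_sum.
rewrite qE; split; first exact: integ_sum.
rewrite E_sum//; apply: eq_bigr => k _; rewrite E_sum//; apply: eq_bigr => l _.
by have [i <-] := E_coord_prod k l; rewrite RintegralZl.
Qed.

Lemma E_dot_prod u v :
  E (fun w => dot (Z w) u * dot (Z w) v) = mxpairing (u *m v^T) Sigma.
Proof.
rewrite -(E_quad _).2; apply: eq_Rintegral => w _.
by rewrite quad_outer !(dotC (Z w)).
Qed.

(** [c^-1 M] has operator norm at most one; if [c = 0] the form vanishes. *)
Lemma quadratic_moment M c : psdmx M -> 0 <= c ->
  (forall v, dot (M *m v) (M *m v) <= c ^+ 2 * dot v v) ->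
  let q := mxpairing M Sigma in
  [/\ integ (fun w => (quad M (Z w) - q) ^+ 2),
      E (fun w => (quad M (Z w) - q) ^+ 2) <= c ^+ 2 * fine (bQ 2%N)
    & 0 <= q].
Proof.
move=> psdM c0 cM q; have [_ qZ [_ _ bq] _] := bZ.
have [iM EM] := E_quad M.
have q0 : 0 <= q by rewrite /q -EM; apply: Rintegral_ge0 => w _; exact: psdM.2.
have [cz|cn0] := eqVneq c 0.
  have M0 v : quad M v = 0.
    rewrite /quad (dot_eq0 (v := M *m v)) ?dot0r//; apply/eqP.
    by rewrite eq_le dot_ge0 andbT (le_trans (cM v))// cz expr0n mul0r.
  have qz : q = 0.
    by rewrite /q -EM -[RHS](E_cst P 0); apply: eq_Rintegral => w _; rewrite M0.
  have -> : (fun w => (quad M (Z w) - q) ^+ 2) = (fun _ => 0).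
    by apply/funext => w; rewrite M0 qz subrr expr0n.
  by split; [exact: integ_cst|rewrite E_cst cz expr0n mul0r|].
have cp : 0 < c by rewrite lt_neqAle eq_sym cn0.
have psdM' : psdmx (c^-1 *: M) by apply: psdZ; rewrite ?invr_ge0.
have opM' : opnorm (c^-1 *: M) <= 1.
  apply: opnorm_le => // v; rewrite expr1n mul1r -scalemxAl dotZl dotZr mulrA.
  by rewrite -expr2 exprVn ler_pdivrMl ?exprn_gt0.
have := qZ 2%N erefl _ psdM' opM'; rewrite /=.
have -> : fine 'E_P[fun w => quad (c^-1 *: M) (Z w)]%E = c^-1 * q.
  rewrite unlock -/(Rintegral P setT _) /q -EM -RintegralZl//.
  by apply: eq_Rintegral => w _; rewrite quadZm.
have sqE w : `|quad (c^-1 *: M) (Z w) - c^-1 * q| ^+ 2 =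
    c^-1 ^+ 2 * (quad M (Z w) - q) ^+ 2.
  by rewrite real_normK ?num_real// quadZm -mulrBr exprMn.
move=> h.
have [||||i2 E2] := @E_of_expectation _ _ _ P
  (fun w => c^-1 ^+ 2 * (quad M (Z w) - q) ^+ 2) (bQ 2%N).
- apply: measurable_funM; first exact: measurable_cst.
  apply: measurable_funX; apply: measurable_funB; first exact: meas_quadZ.
  exact: measurable_cst.
- by move=> w; rewrite mulr_ge0 ?sqr_ge0.
- exact: bq.
- by move: h; congr ('E_P[_] <= _)%E; apply/funext => w; exact: sqE.
have i1 : integ (fun w => (quad M (Z w) - q) ^+ 2).
  have := integZ (c ^+ 2) i2; congr integrable; apply/funext => w /=.
  by rewrite mulrA -exprMn mulfV// expr1n mul1r.
split=> //; move: E2; rewrite RintegralZl// exprVn ler_pdivrMl ?exprn_gt0//.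
Qed.

Lemma bQ2_ge0 : 0 <= fine (bQ 2%N).
Proof.
have psd0 : psdmx (0 : 'M[R]_p).
  by split=> [|v]; rewrite ?trmx0// /quad mul0mx dot0r.
have [|_ + _] := quadratic_moment psd0 ler01.
  by move=> v; rewrite mul0mx dot0r mulr_ge0 ?sqr_ge0// dot_ge0.
rewrite expr1n mul1r; apply: le_trans; apply: Rintegral_ge0 => w _.
exact: sqr_ge0.
Qed.

Section Rank1Change.
Variables (u v : 'cV[R]_p) (N1 N2 : 'M[R]_p) (a b t c : R).
Hypotheses (a0 : 0 <= a) (b0 : 0 <= b) (t0 : 0 < t).
Hypotheses (uc : dot u u <= c) (vc : dot v v <= b ^+ 2 * c).
Hypotheses (N1psd : psdmx N1) (N2psd : psdmx N2).
Hypothesis N12 : forall z, quad N2 z <= b * quad N1 z.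
Hypothesis N1t : forall z, dot (N1 *m z) (N1 *m z) <= t^-1 ^+ 2 * dot z z.
Hypothesis N2t : forall z, dot (N2 *m z) (N2 *m z) <= (b / t) ^+ 2 * dot z z.

Let D w :=
  rank1_change a (dot (Z w) u) (dot (Z w) v) (quad N1 (Z w)) (quad N2 (Z w)).
Hypothesis mD : meas D.

Let c0 : 0 <= c. Proof. exact: le_trans (dot_ge0 u) uc. Qed.

Let s4 := Num.sqrt (fine (bL 4%N)).
Let s40 : 0 <= s4. Proof. exact: sqrtr_ge0. Qed.
Let s4E : s4 ^+ 2 = fine (bL 4%N). Proof. by rewrite sqr_sqrtr// bL4_ge0. Qed.

Let D_le w : `|D w| <=
  2 * a * `|dot (Z w) u * dot (Z w) v| + a * b * dot (Z w) u ^+ 2.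
Proof.
by apply: norm_rank1_change; rewrite ?N12 ?andbT//; [exact: N1psd.2|exact: N2psd.2].
Qed.

Let E_lm2 : integ (fun w => (dot (Z w) u * dot (Z w) v) ^+ 2) /\
  E (fun w => (dot (Z w) u * dot (Z w) v) ^+ 2) <= (b * c * s4) ^+ 2.
Proof.
have [iu Eu] := linear_moment4 uc; have [iv Ev] := linear_moment4 vc.
have sqsq (x : R) : x ^+ 4 = (x ^+ 2) ^+ 2 by rewrite -exprM.
have [||||||||i E1] := @E_cauchy_schwarz _ _ _ P (fun w => dot (Z w) u ^+ 2)
  (fun w => dot (Z w) v ^+ 2) (c * s4) (b ^+ 2 * c * s4).
- by apply: measurable_funX; exact: meas_dotZ.
- by apply: measurable_funX; exact: meas_dotZ.
- by move: iu; congr integrable; apply/funext => w /=; rewrite sqsq.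
- by move: iv; congr integrable; apply/funext => w /=; rewrite sqsq.
- exact: mulr_ge0.
- by rewrite !mulr_ge0// sqr_ge0.
- rewrite exprMn s4E; apply: le_trans Eu; rewrite le_eqVlt; apply/orP; left.
  by apply/eqP/eq_Rintegral => w _; rewrite sqsq.
- rewrite exprMn s4E; apply: le_trans Ev; rewrite le_eqVlt; apply/orP; left.
  by apply/eqP/eq_Rintegral => w _; rewrite sqsq.
have eqf : (fun w => (dot (Z w) u * dot (Z w) v) ^+ 2) =
    (fun w => dot (Z w) u ^+ 2 * dot (Z w) v ^+ 2).
  by apply/funext => w; rewrite exprMn.
rewrite eqf; split=> //.
apply: le_trans (_ : _ <= c * s4 * (b ^+ 2 * c * s4)) _; last first.
  by rewrite le_eqVlt; apply/orP; left; apply/eqP; ring.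
by apply: le_trans E1; apply: E_le (integrable_norm i) _ => // w; exact: ler_norm.
Qed.

(** Square the pointwise bound; the mixed moment [E (l m)^2] is at most the
    geometric mean of the fourth moments of [l] and [m]. *)
Lemma rank1_change_sqr_moment : integ (fun w => D w ^+ 2) /\
  E (fun w => D w ^+ 2) <= 10%:R * (a * b * c) ^+ 2 * fine (bL 4%N).
Proof.
have [ilm Elm] := E_lm2; have [iu Eu] := linear_moment4 uc.
pose g w := 8%:R * a ^+ 2 * (dot (Z w) u * dot (Z w) v) ^+ 2 +
            2%:R * (a * b) ^+ 2 * dot (Z w) u ^+ 4.
have ig : integ g by apply: integD; exact: integZ.
have Dg w : D w ^+ 2 <= g w.
  rewrite -[D w ^+ 2]real_normK ?num_real// /g.
  set x := dot (Z w) u * _; set y := dot (Z w) u.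
  rewrite -[x ^+ 2]real_normK ?num_real//.
  have h : `|D w| <= 2 * (a * `|x|) + a * b * y ^+ 2 by rewrite mulrA; exact: D_le.
  apply: (@le_trans _ _ ((2 * (a * `|x|) + a * b * y ^+ 2) ^+ 2)).
    apply: lerXn2r; rewrite ?nnegrE// addr_ge0//; first by rewrite !mulr_ge0.
    by apply: mulr_ge0 (sqr_ge0 _); exact: mulr_ge0.
  rewrite -subr_ge0 (_ : _ - _ = (2 * (a * `|x|) - a * b * y ^+ 2) ^+ 2) ?sqr_ge0//.
  by move: `|x| y {h} => X Y; ring.
have iD : integ (fun w => D w ^+ 2).
  apply: (integ_dom _ _ ig); first exact: measurable_funX.
  by move=> w; rewrite ger0_norm ?sqr_ge0.
split=> //; apply: le_trans (E_le iD ig Dg) _.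
rewrite /g RintegralD//; [|exact: integZ|exact: integZ].
rewrite !RintegralZl//.
apply: le_trans (lerD (ler_wpM2l _ Elm) (ler_wpM2l _ Eu)) _.
- by rewrite mulr_ge0 ?sqr_ge0.
- by rewrite mulr_ge0 ?sqr_ge0.
by rewrite !exprMn s4E le_eqVlt; apply/orP; left; apply/eqP; ring.
Qed.

(** The value that [E D] would have if the two quadratic forms in its
    denominators and in its quadratic term were equal to their means. It depends
    on the law of [Z] only through the covariance matrix. *)
Definition rank1_proxy : R :=
  let q := mxpairing N1 Sigma in let k := mxpairing N2 Sigma in
  a ^+ 2 * mxpairing (u *m u^T) Sigma * k / (1 + a * q) ^+ 2 -
  2 * a * mxpairing (u *m v^T) Sigma / (1 + a * q).


Let qb := mxpairing N1 Sigma.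
Let kb := mxpairing N2 Sigma.
Let Db w := rank1_change a (dot (Z w) u) (dot (Z w) v) qb kb.

Let qb0 : 0 <= qb.
Proof.
by rewrite /qb -(E_quad N1).2; apply: Rintegral_ge0 => w _; exact: N1psd.2.
Qed.

Let kb0 : 0 <= kb <= b * qb.
Proof.
have [i1 E1] := E_quad N1; have [i2 E2] := E_quad N2.
rewrite /kb /qb -E1 -E2; apply/andP; split.
  by apply: Rintegral_ge0 => w _; exact: N2psd.2.
by rewrite -RintegralZl//; apply: E_le => //; exact: integZ.
Qed.

Let iDb : integ Db /\ E Db = rank1_proxy.
Proof.
have il := linear_prod_integ u u; have ilm := linear_prod_integ u v.
have DbE : Db = fun w =>
    a ^+ 2 * kb / (1 + a * qb) ^+ 2 * (dot (Z w) u * dot (Z w) u) -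
    2 * a / (1 + a * qb) * (dot (Z w) u * dot (Z w) v).
  by apply/funext => w; rewrite /Db /rank1_change; ring.
rewrite DbE; split; first by apply: integB; exact: integZ.
rewrite RintegralB//; [|exact: integZ|exact: integZ].
by rewrite !RintegralZl// !E_dot_prod /rank1_proxy -/qb -/kb; ring.
Qed.

Let dom w := 2 * a * `|dot (Z w) u * dot (Z w) v| + a * b * dot (Z w) u ^+ 2.

Let E_dom : integ dom /\ E dom <= 3 * (b * c) * (a * fine (bL 2%N)).
Proof.
have [iu Eu] := linear_moment2 uc; have [iv Ev] := linear_moment2 vc.
have cL : 0 <= c * fine (bL 2%N) by rewrite mulr_ge0// bL2_ge0.
have [||||||||i E1] := @E_cauchy_schwarz _ _ _ P (fun w => dot (Z w) u)
  (fun w => dot (Z w) v) (Num.sqrt (c * fine (bL 2%N)))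
  (b * Num.sqrt (c * fine (bL 2%N))).
- exact: meas_dotZ.
- exact: meas_dotZ.
- exact: iu.
- exact: iv.
- exact: sqrtr_ge0.
- by rewrite mulr_ge0// sqrtr_ge0.
- by rewrite sqr_sqrtr.
- by rewrite exprMn sqr_sqrtr// mulrA.
have ia := integrable_norm i.
split; first by apply: integD; exact: integZ.
rewrite RintegralD//; [|exact: integZ|exact: integZ].
rewrite !RintegralZl//.
rewrite mulrCA -expr2 sqr_sqrtr// in E1.
apply: le_trans (lerD (ler_wpM2l _ E1) (ler_wpM2l _ Eu)) _.
- by rewrite mulr_ge0.
- by rewrite mulr_ge0.
by rewrite le_eqVlt; apply/orP; left; apply/eqP; ring.
Qed.

Let sQ := Num.sqrt (fine (bQ 2%N)).

(** Freezing a quadratic form at its mean costs its standard deviation times the root mean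
    square of the factor in front. *)
Let E_mul_deviation (f : T -> R) (e : R) (N : 'M[R]_p) (r : R) :
  meas f -> integ (fun w => f w ^+ 2) -> 0 <= e ->
  E (fun w => f w ^+ 2) <= e ^+ 2 -> psdmx N -> 0 <= r ->
  (forall z, dot (N *m z) (N *m z) <= r ^+ 2 * dot z z) ->
  let g w := f w * (quad N (Z w) - mxpairing N Sigma) in
  integ (fun w => `|g w|) /\ E (fun w => `|g w|) <= e * (r * sQ).
Proof.
move=> mf i2 e0 Ef Npsd r0 Nr g; have [iq Eq _] := quadratic_moment Npsd r0 Nr.
have [||||||||ig Eg] := @E_cauchy_schwarz _ _ _ P f
  (fun w => quad N (Z w) - mxpairing N Sigma) e (r * sQ) => //.
- by apply: measurable_funB; [exact: meas_quadZ|exact: measurable_cst].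
- by rewrite mulr_ge0// sqrtr_ge0.
- by rewrite exprMn sqr_sqrtr// bQ2_ge0.
by split=> //; exact: integrable_norm.
Qed.

(** The first entry of the minimum is the cost of freezing the quadratic forms.
    The second bounds [D] and its frozen version separately, which is better when
    the quadratic forms are not concentrated. *)
Lemma rank1_change_mean : integ D /\ `|E D - rank1_proxy| <=
  10%:R * (b * c) * Num.min (a ^+ 2 * sQ * s4 * t^-1) (a * fine (bL 2%N)).
Proof.
have [iDb1 EDb] := iDb; have [idom Edom] := E_dom.
have iD : integ D by apply: integ_dom idom => //; exact: D_le.
split=> //; rewrite -EDb -RintegralB//.
have iDD : integ (fun w => D w - Db w) by exact: integB.
have bc : 0 <= b * c by exact: mulr_ge0.
rewrite [X in _ <= X * _]mulrC -[X in _ <= X]mulrA minr_pMr ?ler0n// minr_pMr//.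
rewrite le_min; apply/andP; split; last first.
  apply: (@le_trans _ _ (E (fun w => 2 * dom w))).
    apply: E_abs_le => //; first exact: integZ.
    move=> w; rewrite mulr_natl mulr2n (le_trans (ler_normB _ _))// lerD//.
      exact: D_le.
    exact: norm_rank1_change.
  rewrite RintegralZl// (le_trans (ler_wpM2l _ Edom))//.
  rewrite -subr_ge0.
  have -> : b * c * (10%:R * (a * fine (bL 2%N))) -
    2 * (3 * (b * c) * (a * fine (bL 2%N))) = 4%:R * (b * c) * (a * fine (bL 2%N)).
    by ring.
  by rewrite !mulr_ge0// bL2_ge0.
have [ilm Elm] := E_lm2; have [iu Eu] := linear_moment4 uc.
have sqsq : (fun w => dot (Z w) u ^+ 4) = (fun w => (dot (Z w) u ^+ 2) ^+ 2).
  by apply/funext => w; rewrite -exprM.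
have ti0 : 0 <= t^-1 by rewrite invr_ge0 ltW.
have mu2 : meas (fun w => dot (Z w) u ^+ 2).
  by apply: measurable_funX; exact: meas_dotZ.
rewrite sqsq in iu Eu; rewrite -s4E -exprMn in Eu.
have cs : 0 <= c * s4 by exact: mulr_ge0.
have [i1 E1] := E_mul_deviation (measurable_funM (meas_dotZ u) (meas_dotZ v))
  ilm (mulr_ge0 bc s40) Elm N1psd ti0 N1t.
have [i2 E2] := E_mul_deviation mu2 iu cs Eu N2psd (divr_ge0 b0 (ltW t0)) N2t.
have [i3 E3] := E_mul_deviation mu2 iu cs Eu N1psd ti0 N1t.
rewrite -/qb -/kb in i1 E1 i2 E2 i3 E3.
pose h w := 2 * a ^+ 2 * `|dot (Z w) u * dot (Z w) v * (quad N1 (Z w) - qb)| +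
  a ^+ 2 * (`|dot (Z w) u ^+ 2 * (quad N2 (Z w) - kb)| +
            2 * b * `|dot (Z w) u ^+ 2 * (quad N1 (Z w) - qb)|).
have i4 : integ (fun w => `|dot (Z w) u ^+ 2 * (quad N2 (Z w) - kb)| +
    2 * b * `|dot (Z w) u ^+ 2 * (quad N1 (Z w) - qb)|).
  by apply: integD => //; exact: integZ.
have ih : integ h by apply: integD; exact: integZ.
apply: (@le_trans _ _ (E h)).
  by apply: E_abs_le => // w; apply: rank1_change_lipschitz => //; exact: N1psd.2.
rewrite /h RintegralD//; [|exact: integZ|exact: integZ].
rewrite !RintegralZl// RintegralD//; last exact: integZ.
rewrite RintegralZl//.
apply: le_trans (lerD (ler_wpM2l _ E1) (ler_wpM2l _ (lerD E2 (ler_wpM2l _ E3)))) _.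
- by rewrite mulr_ge0// sqr_ge0.
- exact: sqr_ge0.
- exact: mulr_ge0.
rewrite -subr_ge0.
set X := (X in 0 <= X).
have -> : X = 5%:R * (b * c) * (a ^+ 2 * sQ * s4 * t^-1) by rewrite /X; ring.
by rewrite !mulr_ge0 ?sqr_ge0 ?sqrtr_ge0.
Qed.

End Rank1Change.

End RandomVector.

(** * Resampling one of several independent vectors *)

Section StateSpace.
Context {R : realType} {p : nat} {I : finType}.

Definition rectangle (B : I -> set 'cV[R]_p) : set (I -> 'cV[R]_p) :=
  [set z | forall i, B i (z i)].

Definition rectangles : set (set (I -> 'cV[R]_p)) :=
  [set rectangle B | B in [set B | forall i, @borel_cV R p (B i)]].

(** Configurations of the vectors with the product sigma-algebra; rectangles are
    taken as generators because they form a pi-system. *)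
Definition state := g_sigma_algebraType rectangles.

Definition update (z : I -> 'cV[R]_p) i e : I -> 'cV[R]_p :=
  fun j => if j == i then e else z j.

Lemma update_eq z i e : update z i e i = e.
Proof. by rewrite /update eqxx. Qed.

Lemma update_neq z i e j : j != i -> update z i e j = z j.
Proof. by rewrite /update => /negPf ->. Qed.

Lemma update_same z i e e' : update (update z i e) i e' = update z i e'.
Proof. by apply/funext => j; rewrite /update; case: (j == i). Qed.

Lemma update_comm z i j e e' : i != j ->
  update (update z i e) j e' = update (update z j e') i e.
Proof.
move=> ij; apply/funext => k; rewrite /update; case: eqP => // ->.
by rewrite eq_sym (negPf ij).
Qed.

Lemma borel_setT : @borel_cV R p setT.
Proof. by apply: sub_sigma_algebra; exact: openT. Qed.

Lemma borel_setI A B : @borel_cV R p A -> @borel_cV R p B -> @borel_cV R p (A `&` B).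
Proof.
pose V : measurableType _ := g_sigma_algebraType [set B : set 'cV[R]_p | open B].
exact: (@measurableI _ V).
Qed.

Lemma rectangles_setI : setI_closed rectangles.
Proof.
move=> _ _ [A mA <-] [B mB <-]; exists (fun i => A i `&` B i).
  by move=> i; apply: borel_setI; [exact: mA|exact: mB].
apply/seteqP; split=> z /=.
  by move=> h; split=> i; case: (h i).
by move=> [hA hB] i; split; [exact: hA|exact: hB].
Qed.

Lemma random_vector_coord i : random_vector (fun z : state => z i).
Proof.
move=> B mB; apply: sub_sigma_algebra.
exists (fun j => if j == i then B else setT) => [j /=|].
  by case: ifP => // _; exact: borel_setT.
apply/seteqP; split=> z /=; first by move=> /(_ i); rewrite eqxx.
by move=> Bz j; case: eqP => // ->.
Qed.

Lemma big_setIP T (s : seq I) (Q : pred I) (F : I -> set T) w :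
  (\big[setI/setT]_(i <- s | Q i) F i) w <->
  forall i, i \in s -> Q i -> F i w.
Proof.
elim: s => [|i s IH]; first by rewrite big_nil; split.
rewrite big_cons; case: ifPn => Qi; split.
- move=> [Fi /IH Fs] j; rewrite inE => /predU1P[->//|]; exact: Fs.
- move=> h; split; first by apply: h; rewrite ?mem_head.
  by apply/IH => j js; apply: h; rewrite inE js orbT.
- move=> /IH Fs j; rewrite inE => /predU1P[->|]; last exact: Fs.
  by rewrite (negPf Qi).
- by move=> h; apply/IH => j js; apply: h; rewrite inE js orbT.
Qed.

Lemma measurable_to_state d (T : measurableType d) (Z : T -> state) :
  (forall i, random_vector (fun w => Z w i)) -> measurable_fun setT Z.
Proof.
move=> rZ; apply: (@measurability _ _ _ _ setT Z rectangles erefl).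
move=> _ [_ [B mB <-] <-]; rewrite setTI.
have -> : Z @^-1` rectangle B =
    \big[setI/setT]_(i in I) ((fun w => Z w i) @^-1` B i).
  apply/seteqP; split=> w /=.
    by move=> h; apply/big_setIP => i _ _; exact: h.
  by move=> /big_setIP h i; apply: h; rewrite ?mem_index_enum.
by apply: bigsetI_measurable => i _; apply: rZ; exact: mB.
Qed.

Definition bounded_measurable (g : state -> R) :=
  measurable_fun setT g /\ exists C, forall z, `|g z| <= C.

Lemma bmB g h : bounded_measurable g -> bounded_measurable h ->
  bounded_measurable (fun z => g z - h z).
Proof.
move=> [mg [C gC]] [mh [D hD]]; split; first exact: measurable_funB.
by exists (C + D) => z; rewrite (le_trans (ler_normB _ _))// lerD.
Qed.

Lemma bm_sqr g : bounded_measurable g -> bounded_measurable (fun z => g z ^+ 2).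
Proof.
move=> [mg [C gC]]; split; first exact: measurable_funX.
exists (C ^+ 2) => z; rewrite normrX; apply: lerXn2r; rewrite ?nnegrE//.
exact: le_trans (gC z).
Qed.

Lemma bm_cst c : bounded_measurable (fun _ => c).
Proof. by split; [exact: measurable_cst|exists `|c|]. Qed.

End StateSpace.
Arguments state : clear implicits.

Section Resampling.
Context {d : measure_display} {T : measurableType d} {R : realType}.
Context {p : nat} {I : finType}.
Variables (P : probability T R) (Z : I -> T -> 'cV[R]_p).
Hypotheses (rZ : forall i, random_vector (Z i)) (indZ : independent_vectors P Z).

Local Notation St := (state R p I).
Local Notation E f := (Rintegral P setT f).
Local Notation integ f := (P.-integrable setT (EFin \o f)).
Local Notation bm := (@bounded_measurable R p I).
Implicit Types (g h : St -> R) (z : St).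

Let Zs (w : T) : St := fun i => Z i w.

(** The conditional expectation of [g] given all coordinates except [i]. *)
Definition resample i g : St -> R := fun z => E (fun w => g (update z i (Z i w))).

Definition indep_coord i g := forall z e, g (update z i e) = g z.

Lemma measurable_update_pair d1 (S : measurableType d1) i (V : S -> St) :
  measurable_fun setT V ->
  measurable_fun setT (fun x : S * T => update (V x.1) i (Z i x.2) : St).
Proof.
move=> mV; apply: measurable_to_state => j B mB.
have [->|ji] := eqVneq j i.
  have -> : (fun x : S * T => update (V x.1) i (Z i x.2) i) @^-1` B =
      snd @^-1` (Z i @^-1` B).
    by apply/seteqP; split=> x /=; rewrite update_eq.
  by rewrite -[X in measurable X]setTI; apply: measurable_snd => //; exact: rZ.
have -> : (fun x : S * T => update (V x.1) i (Z i x.2) j) @^-1` B =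
    fst @^-1` (V @^-1` ((fun z : St => z j) @^-1` B)).
  by apply/seteqP; split=> x /=; rewrite update_neq.
rewrite -[X in measurable X]setTI; apply: measurable_fst => //.
rewrite -[X in measurable X]setTI; apply: mV => //.
exact: random_vector_coord.
Qed.

Lemma measurable_Zs : measurable_fun setT Zs.
Proof. exact: measurable_to_state. Qed.

Lemma prob_rectangle (J : {set I}) (B : I -> set 'cV[R]_p) :
  (forall i, borel_cV (B i)) ->
  P [set w | forall i, i \in J -> B i (Z i w)] =
  (\prod_(i in J) P (Z i @^-1` B i))%E.
Proof.
move=> mB; rewrite -(@indZ J (fun i => Z i @^-1` B i)).
  congr (P _); apply/seteqP; split=> w /=.
    by move=> h; apply/big_setIP => i _; exact: h.
  by move=> /big_setIP h i; apply: h; rewrite ?mem_index_enum.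
by move=> i _; exists (B i) => //; rewrite setTI.
Qed.

(** Replacing one coordinate by an independent copy does not change the joint
    law: both laws agree on rectangles, by independence. *)
Lemma resample_law i (A : set St) : measurable A ->
  pushforward P Zs A =
  pushforward (P \x P)%E (fun x : T * T => update (Zs x.1) i (Z i x.2) : St) A.
Proof.
have m1 := measurable_Zs; have m2 := measurable_update_pair i m1.
pose X1 : {mfun T >-> St} := HB.pack Zs (isMeasurableFun.Build _ _ _ _ _ m1).
pose X2 : {mfun (T * T)%type >-> St} :=
  HB.pack (fun x : T * T => update (Zs x.1) i (Z i x.2) : St)
    (isMeasurableFun.Build _ _ _ _ _ m2).
move=> mA; rewrite -[LHS]/(distribution P X1 A).
rewrite -[RHS]/(distribution (P \x P)%E X2 A).
refine (@measure_unique _ R St rectangles (fun _ => setT) erefl rectangles_setI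
  _ _ (distribution P X1) (distribution (P \x P)%E X2) _ _ A mA).
- move=> _; exists (fun _ => setT) => [j|]; first exact: borel_setT.
  by apply/seteqP; split.
- by rewrite bigcup_const.
- move=> _ [B mB <-]; rewrite -[LHS]/(P (Zs @^-1` rectangle B)).
  rewrite -[RHS]/((P \x P)%E
    ((fun x : T * T => update (Zs x.1) i (Z i x.2)) @^-1` rectangle B)).
  have mZB j : measurable (Z j @^-1` B j) by apply: rZ; exact: mB.
  have -> : Zs @^-1` rectangle B = [set w | forall j, j \in [set: I]%SET -> B j (Z j w)].
    by apply/seteqP; split=> w /= h j; [move=> _|]; apply: h; rewrite ?inE.
  have -> : (fun x : T * T => update (Zs x.1) i (Z i x.2)) @^-1` rectangle B =
      [set w | forall j, j \in (~: [set i])%SET -> B j (Z j w)] `*` (Z i @^-1` B i).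
    apply/seteqP; split=> [[w w'] /= h|[w w'] /= [h1 h2] j].
      split=> [j|]; last by have := h i; rewrite update_eq.
      by rewrite !inE => ji; have := h j; rewrite update_neq.
    have [->|ji] := eqVneq j i; first by rewrite update_eq.
    by rewrite update_neq//; apply: h1; rewrite !inE.
  rewrite [RHS]product_measure1E//; last first.
    rewrite (_ : [set w | _] = \big[setI/setT]_(j in ~: [set i]%SET) (Z j @^-1` B j)).
      by apply: bigsetI_measurable.
    apply/seteqP; split=> w /=; first by move=> h; apply/big_setIP => j _; exact: h.
    by move=> /big_setIP h j; apply: h; rewrite ?mem_index_enum.
  rewrite !prob_rectangle// (bigD1 i) ?inE//= muleC; congr (_ * _)%E.
  rewrite [RHS](@prob_rectangle (~: [set i])%SET B mB).
  by apply: eq_bigl => j; rewrite !inE.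
- by move=> _; rewrite [X in (X < _)%E]probability_setT ltry.
Qed.

Lemma bm_section g i z : bm g ->
  integ (fun w => g (update z i (Z i w))).
Proof.
move=> [mg [C gC]]; apply: (@integ_dom _ _ _ P _ (fun _ => C)).
- have m2 := measurable_update_pair i (@measurable_id _ St setT).
  apply: (measurableT_comp mg).
  exact: (measurableT_comp m2 (@measurable_pair1 _ _ St T z)).
- by move=> w; exact: gC.
- exact: integ_cst.
Qed.

Lemma bm_integ g : bm g -> integ (fun w => g (Zs w)).
Proof.
move=> [mg [C gC]]; apply: (@integ_dom _ _ _ P _ (fun _ => C)).
- exact: (measurableT_comp mg measurable_Zs).
- by move=> w; exact: gC.
- exact: integ_cst.
Qed.

Lemma bm_resample g i : bm g -> bm (resample i g).
Proof.
move=> gb; have [mg [C gC]] := gb; split; last first.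
  exists C => z; rewrite -[leRHS](E_cst P C); apply: E_abs_le => //.
    exact: bm_section.
  exact: integ_cst.
have m2 := measurable_update_pair i (@measurable_id _ St setT).
pose f (x : St * T) := g (update x.1 i (Z i x.2)).
(* Fubini's theorem needs some finite measure on the configurations; a point
   mass will do. *)
pose Q := [the probability St R of \d_(point : St)].
have mf : measurable_fun setT f by exact: measurableT_comp mg m2.
have fi : (Q \x P)%E.-integrable setT (EFin \o f).
  apply: (@integ_dom _ _ _ [the probability _ R of (Q \x P)%E] _ (fun _ => C)).
  - exact: mf.
  - by move=> x; exact: gC.
  - exact: integ_cst.
have mF := measurable_fubini_F fi.
exact: (measurableT_comp (@fine_measurable R setT measurableT) mF).
Qed.

(** Fubini's theorem for the law of the resampled configuration. *)
Lemma E_resample g i : bm g ->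
  E (fun w => resample i g (Zs w)) = E (fun w => g (Zs w)).
Proof.
move=> gb; have [mg [C gC]] := gb.
have m1 := measurable_Zs; have m2 := measurable_update_pair i m1.
pose f (x : T * T) := g (update (Zs x.1) i (Z i x.2)).
have fi : (P \x P)%E.-integrable setT (EFin \o f).
  apply: (@integ_dom _ _ _ [the probability _ R of (P \x P)%E] _ (fun _ => C)).
  - exact: (measurableT_comp mg m2).
  - by move=> x; exact: gC.
  - exact: integ_cst.
have mEg : measurable_fun setT (EFin \o g) by exact/measurable_EFinP.
have e1 : (\int[P]_w (g (Zs w))%:E = \int[pushforward P Zs]_z (g z)%:E)%E.
  by rewrite (integral_pushforward m1)//; exact: bm_integ.
have e2 : (\int[P \x P]_x (f x)%:E =
    \int[pushforward (P \x P)%E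
      (fun x : T * T => update (Zs x.1) i (Z i x.2) : St)]_z (g z)%:E)%E.
  by rewrite (integral_pushforward m2)//; exact: fi.
rewrite /Rintegral e1 (@eq_measure_integral _ _ _ _
  (pushforward (P \x P)%E (fun x : T * T => update (Zs x.1) i (Z i x.2) : St))).
  rewrite -e2 -(integral12_prod_meas1 fi); congr fine; apply: eq_integral => w _.
  by rewrite /resample /Rintegral fineK// integrable_fin_num//; exact: bm_section.
by move=> A mA _; exact: resample_law.
Qed.

End Resampling.

(** * The Efron-Stein inequality *)

Section EfronStein.
Context {d : measure_display} {T : measurableType d} {R : realType}.
Context {p : nat} {I : finType}.
Variables (P : probability T R) (Z : I -> T -> 'cV[R]_p).
Hypotheses (rZ : forall i, random_vector (Z i)) (indZ : independent_vectors P Z).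

Local Notation St := (state R p I).
Local Notation E f := (Rintegral P setT f).
Local Notation integ f := (P.-integrable setT (EFin \o f)).
Local Notation bm := (@bounded_measurable R p I).
Local Notation rs := (resample P Z).
Implicit Types (g h : St -> R) (z : St).

Let Zs (w : T) : St := fun i => Z i w.

Lemma E_sqr_sub (f : T -> R) c : integ f -> integ (fun w => f w ^+ 2) ->
  E (fun w => (f w - c) ^+ 2) = E (fun w => f w ^+ 2) - 2 * c * E f + c ^+ 2.
Proof.
move=> i1 i2.
have -> : (fun w => (f w - c) ^+ 2) = (fun w => f w ^+ 2 - 2 * c * f w + c ^+ 2).
  by apply/funext => w; ring.
rewrite RintegralD//; [|apply: integB => //; exact: integZ|exact: integ_cst].
by rewrite RintegralB//; [rewrite RintegralZl// E_cst|exact: integZ].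
Qed.

Lemma E_sqr_sub_mean_le (f : T -> R) c : integ f -> integ (fun w => f w ^+ 2) ->
  E (fun w => f w ^+ 2) - E f ^+ 2 <= E (fun w => (f w - c) ^+ 2).
Proof.
move=> i1 i2; rewrite E_sqr_sub// -subr_ge0.
by rewrite (_ : _ - _ = (E f - c) ^+ 2) ?sqr_ge0//; ring.
Qed.

Lemma sqr_E_le (f : T -> R) : integ f -> integ (fun w => f w ^+ 2) ->
  E f ^+ 2 <= E (fun w => f w ^+ 2).
Proof.
move=> i1 i2; have : 0 <= E (fun w => (f w - E f) ^+ 2).
  by apply: Rintegral_ge0 => w _; exact: sqr_ge0.
rewrite E_sqr_sub//; lra.
Qed.

Lemma indep_coord_resample_self i g : indep_coord i (rs i g).
Proof.
by move=> z e; apply: eq_Rintegral => w _; rewrite update_same.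
Qed.

Lemma indep_coord_resample i j g : indep_coord j g -> indep_coord j (rs i g).
Proof.
have [->|ij] := eqVneq j i; first by move=> _; exact: indep_coord_resample_self.
by move=> gj z e; apply: eq_Rintegral => w _; rewrite update_comm.
Qed.

Fixpoint resample_seq (s : seq I) g : St -> R :=
  if s is i :: s' then resample_seq s' (rs i g) else g.

Lemma E_resample_seq s g : bm g ->
  E (fun w => resample_seq s g (Zs w)) = E (fun w => g (Zs w)).
Proof.
elim: s g => //= i s IH g gb; rewrite IH; last exact: bm_resample.
exact: E_resample.
Qed.

Lemma indep_coord_resample_seq s j g : indep_coord j g \/ j \in s ->
  indep_coord j (resample_seq s g).
Proof.
elim: s j g => [|i s IH] j g /=; first by rewrite in_nil => -[].
rewrite inE => -[gj|/orP[/eqP ->|js]]; apply: IH.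
- by left; exact: indep_coord_resample.
- by left; exact: indep_coord_resample_self.
- by right.
Qed.

(** Change the coordinates one at a time. *)
Lemma indep_coord_cst g z : (forall i, indep_coord i g) -> forall z', g z' = g z.
Proof.
move=> gi z'.
have h (s : seq I) : g (fun j => if j \in s then z' j else z j) = g z.
  elim: s => [|i s IH]; first by congr g; apply/funext.
  rewrite -[RHS]IH -[RHS](gi i _ (z' i)); congr g; apply/funext => j.
  by rewrite /update inE; case: eqP => //= ->.
by rewrite -(h (enum I)); congr g; apply/funext => j; rewrite mem_enum.
Qed.

(** The second moment lost by averaging out coordinate [i] is at most the mean
    square distance to any function that ignores this coordinate; averaging
    further coordinates only decreases that distance. *)
Lemma resample_seq_sqr_loss s g (f : I -> St -> R) :
  bm g -> (forall i, bm (f i)) -> (forall i, indep_coord i (f i)) ->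
  E (fun w => g (Zs w) ^+ 2) - E (fun w => resample_seq s g (Zs w) ^+ 2) <=
  \sum_(i <- s) E (fun w => (g (Zs w) - f i (Zs w)) ^+ 2).
Proof.
elim: s g f => [|i s IH] g f gb fb fi; first by rewrite big_nil subrr.
rewrite big_cons /=.
have gb' := bm_resample P rZ i gb.
have fb' j := bm_resample P rZ i (fb j).
have step : E (fun w => g (Zs w) ^+ 2) - E (fun w => rs i g (Zs w) ^+ 2) <=
    E (fun w => (g (Zs w) - f i (Zs w)) ^+ 2).
  have g2 := bm_sqr gb; have d2 := bm_sqr (bmB gb (fb i)).
  rewrite -(E_resample rZ indZ i g2) -(E_resample rZ indZ i d2).
  rewrite -RintegralB//; [|exact: (bm_integ P rZ (bm_resample P rZ i g2))|
    exact: (bm_integ P rZ (bm_sqr gb'))].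
  apply: E_le.
  - apply: integB; first exact: (bm_integ P rZ (bm_resample P rZ i g2)).
    exact: (bm_integ P rZ (bm_sqr gb')).
  - exact: (bm_integ P rZ (bm_resample P rZ i d2)).
  - move=> w; rewrite /resample.
    under [X in _ <= Rintegral _ _ X]eq_fun do rewrite (fi i).
    apply: E_sqr_sub_mean_le; first exact: (bm_section P rZ).
    exact: (bm_section P rZ i (Zs w) g2).
have jensen j : E (fun w => (rs i g (Zs w) - rs i (f j) (Zs w)) ^+ 2) <=
    E (fun w => (g (Zs w) - f j (Zs w)) ^+ 2).
  have db := bmB gb (fb j); have d2 := bm_sqr db.
  rewrite -(E_resample rZ indZ i d2); apply: E_le.
  - exact: (bm_integ P rZ (bm_sqr (bmB gb' (fb' j)))).
  - exact: (bm_integ P rZ (bm_resample P rZ i d2)).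
  - move=> w; rewrite /resample -RintegralB//; [|exact: (bm_section P rZ)..].
    apply: sqr_E_le; first exact: (bm_section P rZ i (Zs w) db).
    exact: (bm_section P rZ i (Zs w) d2).
have := IH _ _ gb' fb' (fun j => @indep_coord_resample i j _ (fi j)).
move=> IHs; apply: le_trans (lerD step (le_trans IHs (ler_sum _ _))).
  by rewrite addrA subrK.
by move=> j _; exact: jensen.
Qed.

(** Averaging over every coordinate leaves a constant, which is the mean of [g];
    the loss of second moment is then the whole variance. *)
Lemma efron_stein g (f : I -> St -> R) :
  bm g -> (forall i, bm (f i)) -> (forall i, indep_coord i (f i)) ->
  ('V_P[fun w => g (Zs w)] <=
   (\sum_i E (fun w => (g (Zs w) - f i (Zs w)) ^+ 2))%:E)%E.
Proof.
move=> gb fb fi.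
have ig := bm_integ P rZ gb; have ig2 := bm_integ P rZ (bm_sqr gb).
pose m := E (fun w => g (Zs w)).
have -> : 'V_P[fun w => g (Zs w)]%E = (E (fun w => (g (Zs w) - m) ^+ 2))%:E.
  rewrite /variance unlock unlock /Rintegral fineK; last first.
    apply: integrable_fin_num => //; exact: (bm_integ P rZ (bm_sqr (bmB gb (bm_cst m)))).
  by apply: eq_integral => w _; rewrite expr2.
rewrite lee_fin E_sqr_sub// -/m.
have := resample_seq_sqr_loss (index_enum I) gb fb fi.
pose G := resample_seq (index_enum I) g.
have Gm w : G (Zs w) = m.
  have Gcst := @indep_coord_cst G (Zs w) (fun i =>
    indep_coord_resample_seq (or_intror (mem_index_enum i))).
  rewrite /m -(E_resample_seq (index_enum I) gb) -[LHS](E_cst P).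
  by apply: eq_Rintegral => w' _; rewrite [RHS]Gcst.
have -> : E (fun w => resample_seq (index_enum I) g (Zs w) ^+ 2) = m ^+ 2.
  by rewrite -[RHS](E_cst P); apply: eq_Rintegral => w _; rewrite -/G Gm.
lra.
Qed.

End EfronStein.

(** * The quadratic functional of the resolvent *)

Lemma norm_sub_le (R : realDomainType) (r s m : R) :
  0 <= r <= m -> 0 <= s <= m -> `|r - s| <= m.
Proof.
by move=> /andP[r0 rm] /andP[s0 sm]; rewrite ler_norml; apply/andP; split; lra.
Qed.

Section Functional.
Context {R : realType} {n p : nat}.
Variables (rad : 'I_n -> R) (A S : 'M[R]_p) (t : R) (x : 'cV[R]_p).
Hypotheses (A0 : posdefmx A) (t0 : 0 < t) (tA : loewner_le t%:M A) (S0 : psdmx S).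
Implicit Types (z : 'I_n -> 'cV[R]_p) (e : 'cV[R]_p).

Local Notation M := (Mmx rad A).
Local Notation F := (Ffun rad A S x).
Local Notation upd z i e := (@update R p 'I_n z i e).
Let xAx := quad (invmx A) x.
Let b := b_eps A S.
Let a i := rad i ^+ 2 / n%:R.

Lemma loewner_Mmx z : loewner_le A (M z).
Proof.
rewrite /loewner_le /Mmx addrK; apply: psdZ; first by rewrite invr_ge0.
by apply: psd_sum => i; apply: psdZ (psd_outer _); exact: sqr_ge0.
Qed.

Lemma posdef_Mmx z : posdefmx (M z).
Proof. exact: posdef_loewner A0 (loewner_Mmx z). Qed.

Lemma FfunE z : F z = quad S (invmx (M z) *m x).
Proof.
have Ms : (invmx (M z))^T = invmx (M z).
  by rewrite invmx_sym//; case: (posdef_Mmx z).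
by rewrite /Ffun /quad -!mulmxA (dot_sym _ _ Ms).
Qed.

Let bM z v : quad S v <= b * quad (M z) v.
Proof.
apply: le_trans (quad_le_b_eps _ _ A0) _.
rewrite ler_wpM2l ?b_eps_ge0//; exact: loewner_quad (loewner_Mmx z).
Qed.

Let tM z v : t * dot v v <= quad (M z) v.
Proof.
rewrite -quad_scalar (le_trans (loewner_quad _ tA))//.
exact: loewner_quad (loewner_Mmx z).
Qed.

Lemma Ffun_bounds z : 0 <= F z <= b * xAx.
Proof.
rewrite FfunE S0.2 (le_trans (bM z _))// ler_wpM2l ?b_eps_ge0//.
rewrite quad_invmx; last exact: posdef_Mmx.
exact: quad_invmx_anti A0 (loewner_Mmx z).
Qed.

Lemma Mmx_update z i e : M (upd z i e) = M (upd z i 0) + a i *: (e *m e^T).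
Proof.
rewrite /Mmx addrAC; congr (_ + A).
rewrite (bigD1 i)//= [in RHS](bigD1 i)//= !update_eq mul0mx scaler0 add0r.
rewrite scalerDr scalerA mulrC addrC; congr (_ + _); congr (_ *: _).
by apply: eq_bigr => j ji; rewrite !update_neq.
Qed.

(** The baseline sets vector [i] to zero, which leaves a matrix that does not
    depend on this vector and still dominates [A]. *)
Lemma Ffun_update z i e :
  let G := invmx (M (upd z i 0)) in
  F (upd z i e) - F (upd z i 0) =
  rank1_change (a i) (dot e (G *m x)) (dot e (G *m S *m G *m x))
    (quad G e) (quad (G *m S *m G) e).
Proof.
move=> G; rewrite !FfunE Mmx_update resolvent_rank1; last 2 first.
- exact: posdef_Mmx.
- by rewrite divr_ge0 ?sqr_ge0.
have Gs : G^T = G by rewrite invmx_sym//; case: (posdef_Mmx (upd z i 0)).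
rewrite -/G -scaleNr quadD ?S0.1// quadZv sqrrN.
have -> : quad (G *m S *m G) e = quad S (G *m e).
  by rewrite /quad -!mulmxA (dot_sym e _ Gs).
have -> : dot e (G *m S *m G *m x) = dot (G *m x) (S *m (G *m e)).
  by rewrite -!mulmxA (dot_sym e _ Gs) dotC [RHS](dot_sym _ _ S0.1).
rewrite -scalemxAr dotZr /rank1_change.
by set c := 1 + _; rewrite -exprVn; ring.
Qed.

Lemma measurable_Ffun d (T : measurableType d) (z : T -> 'I_n -> 'cV[R]_p) :
  (forall i, mx_measurable (fun w => z w i)) ->
  measurable_fun setT (fun w => F (z w)).
Proof.
move=> mz; under eq_fun do rewrite FfunE.
have mM : mx_measurable (fun w => invmx (M (z w))).
  apply: mx_measurable_invmx => [|w]; last exact/posdef_unitmx/posdef_Mmx.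
  apply: mx_measurableD; last exact: mx_measurable_cst.
  apply: mx_measurableZ; first exact: measurable_cst.
  apply: mx_measurable_sum => i; apply: mx_measurableZ; first exact: measurable_cst.
  by apply: mx_measurableM => //; exact: mx_measurable_tr.
apply: measurable_quad; first exact: mx_measurable_cst.
by apply: mx_measurableM => //; exact: mx_measurable_cst.
Qed.

Section OneVector.
Context {d : measure_display} {T : measurableType d} (P : probability T R).
Variables (Z : T -> 'cV[R]_p) (Sigma : 'M[R]_p) (bL bQ : nat -> \bar R).
Hypotheses (p_gt0 : (0 < p)%N) (rZ : random_vector Z) (Z0 : has_mean0 P Z).
Hypotheses (ZSigma : has_covmx P Z Sigma) (bZ : moment_controls P Z bL bQ).
Variables (z : 'I_n -> 'cV[R]_p) (i : 'I_n).

Local Notation E f := (Rintegral P setT f).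
Local Notation integ f := (P.-integrable setT (EFin \o f)).

Let G := invmx (M (upd z i 0)).
Let D w := F (upd z i (Z w)) - F (upd z i 0).

(** A common approximation, for all vectors with covariance [Sigma], of the mean
    change of the functional when vector [i] is inserted. *)
Definition update_proxy : R :=
  rank1_proxy Sigma (G *m x) (G *m S *m G *m x) G (G *m S *m G) (a i).

Let mF : measurable_fun setT (fun w => F (upd z i (Z w))).
Proof.
apply: measurable_Ffun => j; have [->|ji] := eqVneq j i.
  by under eq_fun do rewrite update_eq; exact: random_vector_measurable.
by under eq_fun do rewrite update_neq//; exact: mx_measurable_cst.
Qed.

Let mD : measurable_fun setT D.
Proof. by apply: measurable_funB => //; exact: measurable_cst. Qed.

Let M0 := posdef_Mmx (upd z i 0).
Let a0 : 0 <= a i. Proof. by rewrite divr_ge0 ?sqr_ge0. Qed.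
Let b0 : 0 <= b. Proof. exact: b_eps_ge0. Qed.
Let DE : D = fun w => rank1_change (a i) (dot (Z w) (G *m x))
  (dot (Z w) (G *m S *m G *m x)) (quad G (Z w)) (quad (G *m S *m G) (Z w)).
Proof. by apply/funext => w; exact: Ffun_update. Qed.

Let Gx : quad G x <= xAx.
Proof. exact: quad_invmx_anti A0 (loewner_Mmx _). Qed.

Let u_le : dot (G *m x) (G *m x) <= xAx / t.
Proof.
rewrite ler_pdivlMr// mulrC (le_trans (resolvent_sqr_le M0 (tM _) x))//.
Qed.

Let v_le : dot (G *m S *m G *m x) (G *m S *m G *m x) <= b ^+ 2 * (xAx / t).
Proof.
rewrite mulrA ler_pdivlMr// mulrC.
rewrite (le_trans (sandwich_sqr_le M0 S0 (tM _) (bM _) x))//.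
by rewrite ler_wpM2l// sqr_ge0.
Qed.

(** The entry 1 of the minimum comes from [0 <= F <= b xAx]. *)
Lemma update_sqr_moment : E (fun w => D w ^+ 2) <=
  10%:R * xAx ^+ 2 * b ^+ 2 *
  Num.min (rad i ^+ 4 / n%:R ^+ 2 * (1 / t ^+ 2) * fine (bL 4%N)) 1.
Proof.
have mD' := mD; rewrite DE in mD'.
have [i2 h] := rank1_change_sqr_moment p_gt0 rZ bZ a0 b0 u_le v_le
  (psd_invmx M0) (psd_sandwich M0 S0) (sandwich_quad_le M0 (bM _)) mD'.
have xAx0 : 0 <= xAx by exact: (psd_invmx A0).2.
rewrite minr_pMr ?mulr_ge0 ?sqr_ge0// le_min; apply/andP; split.
  rewrite DE (le_trans h)// le_eqVlt; apply/orP; left; apply/eqP.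
  have n0 : n%:R != 0 :> R by rewrite pnatr_eq0 -lt0n (leq_ltn_trans _ (ltn_ord i)).
  by rewrite /a; field; rewrite n0 gt_eqF.
rewrite mulr1 -(E_cst P (10%:R * xAx ^+ 2 * b ^+ 2)); apply: E_le.
- by rewrite DE.
- exact: integ_cst.
move=> w; apply: (@le_trans _ _ ((b * xAx) ^+ 2)).
  rewrite -[D w ^+ 2]real_normK ?num_real//; apply: lerXn2r; rewrite ?nnegrE//.
    by rewrite mulr_ge0.
  exact: norm_sub_le (Ffun_bounds _) (Ffun_bounds _).
rewrite -subr_ge0 exprMn.
rewrite (_ : _ - _ = 9%:R * (b ^+ 2 * xAx ^+ 2)); last by ring.
by rewrite !mulr_ge0 ?sqr_ge0.
Qed.

Lemma update_mean : (0 < n)%N -> `|E D - update_proxy| <=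
  swap_bound 10%:R (b * (xAx / t)) t n (rad i) bL bQ.
Proof.
move=> n0; have mD' := mD; rewrite DE in mD'.
have [_] := rank1_change_mean p_gt0 rZ Z0 ZSigma bZ a0 b0 t0 u_le v_le
  (psd_invmx M0) (psd_sandwich M0 S0) (sandwich_quad_le M0 (bM _))
  (resolvent_dot_le M0 t0 (tM _)) (sandwich_dot_le M0 S0 t0 (tM _) (bM _)) mD'.
rewrite -DE => h; rewrite (le_trans h)// /swap_bound.
rewrite le_eqVlt; apply/orP; left; apply/eqP; congr (_ * Num.min _ _).
have nn : 0 < n%:R :> R by rewrite ltr0n.
have -> : n%:R `^ (3 / 2) = n%:R * Num.sqrt n%:R :> R.
  rewrite (_ : 3 / 2 = 1 + 2^-1); last by field.
  by rewrite powRD ?powRr1 ?powR12_sqrt ?ltW//; apply/implyP => _; rewrite gt_eqF.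
have q0 : 0 <= fine (bQ 2%N) by exact: bQ2_ge0 p_gt0 rZ Z0 ZSigma bZ.
rewrite sqrtrM// sqrtrV ?ltW// /a exprMn exprVn -exprM.
have sn : Num.sqrt n%:R != 0 :> R by rewrite gt_eqF// sqrtr_gt0.
have sn2 : Num.sqrt n%:R ^+ 2 = n%:R :> R by rewrite sqr_sqrtr// ltW.
have -> : rad i ^+ 4 / (n%:R * Num.sqrt n%:R) *
    (Num.sqrt (fine (bQ 2)) / Num.sqrt n%:R) =
    rad i ^+ 4 / (n%:R * Num.sqrt n%:R ^+ 2) * Num.sqrt (fine (bQ 2)).
  by field; rewrite sn gt_eqF.
by rewrite sn2 -expr2.
Qed.

End OneVector.

End Functional.

(** * Swapping one family for the other *)

Section JointIndependence.
Context {d : measure_display} {T : measurableType d} {R : realType}.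
Variables (P : probability T R) (p : nat).

Definition sum_family {I J : Type} (X : I -> T -> 'cV[R]_p) (Y : J -> T -> 'cV[R]_p)
  (s : I + J) : T -> 'cV[R]_p := match s with inl i => X i | inr j => Y j end.

Lemma sigma_of_family_bigI (I : finType) (Z : I -> T -> 'cV[R]_p)
    (Q : pred I) (B : I -> set T) :
  (forall i, Q i -> sigma_of (Z i) (B i)) ->
  sigma_of_family Z (\big[setI/setT]_(i | Q i) B i).
Proof.
move=> mB.
pose V : measurableType _ := g_sigma_algebraType (\bigcup_i sigma_of (Z i)).
apply: (@bigsetI_measurable _ V) => i Qi.
by apply: sub_sigma_algebra; exists i => //; exact: mB.
Qed.

(** An intersection over a subset of the disjoint union splits into one event of
    each family. *)
Lemma independent_sum_family (I J : finType) (X : I -> T -> 'cV[R]_p)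
    (Y : J -> T -> 'cV[R]_p) :
  independent_vectors P X -> independent_vectors P Y ->
  independent_families P X Y -> independent_vectors P (sum_family X Y).
Proof.
move=> indX indY indXY K B mB.
rewrite !big_sumType /=.
rewrite indXY; last 2 first.
- by apply: sigma_of_family_bigI => i iK; exact: (mB (inl i)).
- by apply: sigma_of_family_bigI => j jK; exact: (mB (inr j)).
have eX : (P (\big[setI/setT]_(i | inl i \in K) B (inl i)) =
    \prod_(i | inl i \in K) P (B (inl i)))%E.
  pose L := [set i | inl i \in K]%SET.
  have LE i : (i \in L) = (inl i \in K) by rewrite inE.
  rewrite -(eq_bigl _ _ LE) -[RHS](eq_bigl _ _ LE); apply: indX => i.
  by rewrite LE => /(mB (inl i)).
have eY : (P (\big[setI/setT]_(j | inr j \in K) B (inr j)) =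
    \prod_(j | inr j \in K) P (B (inr j)))%E.
  pose L := [set j | inr j \in K]%SET.
  have LE j : (j \in L) = (inr j \in K) by rewrite inE.
  rewrite -(eq_bigl _ _ LE) -[RHS](eq_bigl _ _ LE); apply: indY => j.
  by rewrite LE => /(mB (inr j)).
by rewrite eX eY.
Qed.

End JointIndependence.

Section MainBounds.
Context {R : realType} {n p : nat}.
Context {d : measure_display} {T : measurableType d} (P : probability T R).
Variables (rad : 'I_n -> R) (A S : 'M[R]_p) (t : R) (x : 'cV[R]_p).
Hypotheses (n_gt0 : (0 < n)%N) (p_gt0 : (0 < p)%N).
Hypotheses (A0 : posdefmx A) (t0 : 0 < t) (tA : loewner_le t%:M A) (S0 : psdmx S).
Variables (X Y : 'I_n -> T -> 'cV[R]_p) (Sigma : 'I_n -> 'M[R]_p).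
Variables (bLX bQX bLY bQY : 'I_n -> nat -> \bar R).
Hypotheses (rX : forall j, random_vector (X j)) (rY : forall j, random_vector (Y j)).
Hypotheses (indX : independent_vectors P X) (indY : independent_vectors P Y).
Hypothesis indXY : independent_families P X Y.
Hypotheses (X0 : forall j, has_mean0 P (X j)) (Y0 : forall j, has_mean0 P (Y j)).
Hypotheses (XSigma : forall j, has_covmx P (X j) (Sigma j)).
Hypotheses (YSigma : forall j, has_covmx P (Y j) (Sigma j)).
Hypotheses (mcX : forall j, moment_controls P (X j) (bLX j) (bQX j)).
Hypotheses (mcY : forall j, moment_controls P (Y j) (bLY j) (bQY j)).

Local Notation E f := (Rintegral P setT f).
Local Notation integ f := (P.-integrable setT (EFin \o f)).
Local Notation F := (Ffun rad A S x).
Let xAx := quad (invmx A) x.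
Let b := b_eps A S.

Lemma bm_Ffun (I : finType) (h : (I -> 'cV[R]_p) -> 'I_n -> 'cV[R]_p) :
  (forall j, (exists i, forall z, h z j = z i) \/ (forall z, h z j = 0)) ->
  bounded_measurable (fun z : state R p I => F (h z)).
Proof.
move=> hE; split; last first.
  exists (b * xAx) => z; have /andP[h0 h1] := Ffun_bounds rad x A0 S0 (h z).
  by rewrite ger0_norm.
apply: measurable_Ffun => // j; have [[i hi]|h0] := hE j.
  refine (@eq_mx_measurable _ (state R p I) _ _ _ (fun z => h z j)
    (fun z => z i) hi _).
  exact: random_vector_measurable (random_vector_coord i).
refine (@eq_mx_measurable _ (state R p I) _ _ _ (fun z => h z j)
  (fun _ => 0) h0 _).
exact: mx_measurable_cst.
Qed.

(** The Efron-Stein inequality with the functionals of the configurations in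
    which one vector is replaced by zero. *)
Lemma variance_Ffun_le :
  ('V_P[fun w => F (fun i => X i w)] <=
   (10%:R * xAx ^+ 2 * b ^+ 2 * \sum_(i < n)
     Num.min (rad i ^+ 4 / n%:R ^+ 2 * (1 / t ^+ 2) * fine (bLX i 4%N)) 1)%:E)%E.
Proof.
pose g (z : state R p 'I_n) := F z.
pose f (i : 'I_n) (z : state R p 'I_n) := F (update z i 0).
have gb : bounded_measurable g by apply: (bm_Ffun (h := id)) => j; left; exists j.
have fb i : bounded_measurable (f i).
  apply: (bm_Ffun (h := fun z => update z i 0)) => j.
  have [->|ji] := eqVneq j i; first by right=> z; rewrite update_eq.
  by left; exists j => z; rewrite update_neq.
have fi i : indep_coord i (f i) by move=> z e; rewrite /f update_same.
apply: le_trans (efron_stein rX indX gb fb fi) _; rewrite lee_fin mulr_sumr.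
apply: ler_sum => i _.
have db := bm_sqr (bmB gb (fb i)).
rewrite -(E_resample rX indX i db) -[leRHS](E_cst P); apply: E_le.
- exact: (bm_integ P rX (bm_resample P rX i db)).
- exact: integ_cst.
move=> w; rewrite /resample /g /f.
under [X in Rintegral _ _ X <= _]eq_fun do rewrite update_same.
exact: (update_sqr_moment rad x A0 t0 tA S0 p_gt0 (rX i) (mcX i)).
Qed.

Let Z := sum_family X Y.
Let rZ s : random_vector (Z s). Proof. by case: s. Qed.
Let indZ : independent_vectors P Z. Proof. exact: independent_sum_family. Qed.

(** The interpolating configurations of Lindeberg's swapping argument. *)
Let mix k (z : 'I_n + 'I_n -> 'cV[R]_p) : 'I_n -> 'cV[R]_p :=
  fun j => if (j < k)%N then z (inl j) else z (inr j).

Let g k (z : state R p ('I_n + 'I_n)%type) := F (mix k z).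

Let gb k : bounded_measurable (g k).
Proof.
apply: bm_Ffun => j; left.
by case jk : (j < k)%N; [exists (inl j)|exists (inr j)] => z; rewrite /mix jk.
Qed.

Let Zs w : 'I_n + 'I_n -> 'cV[R]_p := fun s => Z s w.

Let mix_inl (i : 'I_n) z e : mix i.+1 (update z (inl i) e) = update (mix i z) i e.
Proof.
apply/funext => j; rewrite /mix /update ltnS leq_eqVlt.
rewrite (inj_eq val_inj); case: eqVneq => [->|ji] /=; first by rewrite eqxx.
by case: ifP => // _; rewrite (inj_eq (@inl_inj _ _)) (negPf ji).
Qed.

Let mix_inr (i : 'I_n) z e : mix i (update z (inr i) e) = update (mix i z) i e.
Proof.
apply/funext => j; rewrite /mix /update; case: (eqVneq j i) => [->|ji].
  by rewrite ltnn eqxx.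
by case: ifP => // _; rewrite (inj_eq (@inr_inj _ _)) (negPf ji).
Qed.

(** Conditionally on all other vectors, inserting [X i] or [Y i] in place of zero
    changes the mean of the functional by almost the same amount, namely
    [update_proxy], which sees only their common covariance matrix. *)
Lemma swap_le (i : 'I_n) :
  `|E (fun w => g i.+1 (Zs w)) - E (fun w => g i (Zs w))| <=
  swap_bound 10%:R (b * (xAx / t)) t n (rad i) (bLX i) (bQX i) +
  swap_bound 10%:R (b * (xAx / t)) t n (rad i) (bLY i) (bQY i).
Proof.
rewrite -(E_resample rZ indZ (inl i) (gb i.+1)) -(E_resample rZ indZ (inr i) (gb i)).
have b1 := bm_resample P rZ (inl i) (gb i.+1).
have b2 := bm_resample P rZ (inr i) (gb i).
rewrite -RintegralB//; [|exact: (bm_integ P rZ b1)|exact: (bm_integ P rZ b2)].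
rewrite -[leRHS](E_cst P); apply: E_abs_le.
- exact: (bm_integ P rZ (bmB b1 b2)).
- exact: integ_cst.
move=> w; pose z := mix i (Zs w).
have hX := update_mean rad x A0 t0 tA S0 p_gt0 (rX i) (X0 i) (XSigma i) (mcX i)
  z i n_gt0.
have hY := update_mean rad x A0 t0 tA S0 p_gt0 (rY i) (Y0 i) (YSigma i) (mcY i)
  z i n_gt0.
have sec (s : 'I_n + 'I_n) k (V : T -> 'cV[R]_p) :
    (fun w' => g k (update (Zs w) s (Z s w'))) = (fun w' => F (update z i (V w'))) ->
    E (fun w' => F (update z i (V w')) - F (update z i 0)) =
    resample P Z s (g k) (Zs w) - F (update z i 0).
  move=> e; rewrite /resample e RintegralB//; last exact: integ_cst.
    by rewrite E_cst.
  by rewrite -e; exact: (bm_section P rZ s (Zs w) (gb k)).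
rewrite (sec (inl i) i.+1) in hX; last by apply/funext => w'; rewrite /g mix_inl.
rewrite (sec (inr i) i) in hY; last by apply/funext => w'; rewrite /g mix_inr.
rewrite -/(b) -/xAx in hX hY.
set pr := update_proxy _ _ _ _ _ _ _ in hX hY.
set rX' := resample P Z (inl i) _ _ in hX *.
set rY' := resample P Z (inr i) _ _ in hY *.
have -> : rX' - rY' =
    (rX' - F (update z i 0) - pr) - (rY' - F (update z i 0) - pr) by ring.
by apply: le_trans (ler_normB _ _) _; exact: lerD.
Qed.

Lemma mean_Ffun_swap_le :
  (`|'E_P[(fun w => F (fun i => X i w) - F (fun i => Y i w))%R]| <=
   (\sum_(i < n)
     (swap_bound 10%:R (b * (xAx / t)) t n (rad i) (bLX i) (bQX i) +
      swap_bound 10%:R (b * (xAx / t)) t n (rad i) (bLY i) (bQY i)))%:E)%E.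
Proof.
have gX w : g n (Zs w) = F (fun i => X i w).
  by congr F; apply/funext => i; rewrite /mix ltn_ord.
have gY w : g 0 (Zs w) = F (fun i => Y i w).
  by congr F; apply/funext => i.
have iX := bm_integ P rZ (gb n); have iY := bm_integ P rZ (gb 0).
have -> : 'E_P[(fun w => F (fun i => X i w) - F (fun i => Y i w))%R]%E =
    (E (fun w => g n (Zs w)) - E (fun w => g 0 (Zs w)))%:E.
  rewrite -RintegralB// unlock /Rintegral fineK; last first.
    by apply: integrable_fin_num => //; exact: (integB iX iY).
  by apply: eq_integral => w _; rewrite gX gY.
rewrite /= lee_fin.
rewrite -(telescope_sumr (fun k => E (fun w => g k (Zs w))) (leq0n n)) big_mkord.
by rewrite (le_trans (ler_norm_sum _ _ _))// ler_sum// => i _; exact: swap_le.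
Qed.

End MainBounds.

Theorem theorem3p7 (R : realType) :
  exists K : R, 0 < K /\
  forall (c C : R), 0 < c ->
  forall (n p : nat), (0 < n)%N -> (0 < p)%N -> c <= p%:R / n%:R <= C ->
  forall (d : measure_display) (T : measurableType d) (P : probability T R)
    (X Y : 'I_n -> T -> 'cV[R]_p) (Sigma : 'I_n -> 'M[R]_p)
    (bLX bQX bLY bQY : 'I_n -> nat -> \bar R)
    (rad : 'I_n -> R) (A Sigma_eps : 'M[R]_p) (t : R) (x : 'cV[R]_p),
  (forall j, random_vector (X j)) -> (forall j, random_vector (Y j)) ->
  independent_vectors P X -> independent_vectors P Y ->
  independent_families P X Y ->
  (forall j, has_mean0 P (X j)) -> (forall j, has_mean0 P (Y j)) ->
  (forall j, has_covmx P (X j) (Sigma j)) ->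
  (forall j, has_covmx P (Y j) (Sigma j)) ->
  (forall j, moment_controls P (X j) (bLX j) (bQX j)) ->
  (forall j, moment_controls P (Y j) (bLY j) (bQY j)) ->
  (forall i, 0 < rad i) ->
  posdefmx A -> 0 < t -> loewner_le t%:M A ->
  psdmx Sigma_eps ->
  let FX := fun w => Ffun rad A Sigma_eps x (fun i => X i w) in
  let FY := fun w => Ffun rad A Sigma_eps x (fun i => Y i w) in
  let xAx := quad (invmx A) x in
  let b := b_eps A Sigma_eps in
  ('V_P[FX] <=
     (K * xAx ^+ 2 * b ^+ 2 *
      \sum_(i < n) Num.min
        (rad i ^+ 4 / n%:R ^+ 2 * (1 / t ^+ 2) * fine (bLX i 4%N)) 1)%:E)%E /\
  exists UX UY : 'I_n -> R,
    [/\ (`|'E_P[(fun w => FX w - FY w)%R]| <= (\sum_(i < n) (UX i + UY i))%:E)%E,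
        (forall i, UX i <=
           swap_bound K (b * (xAx / t)) t n (rad i) (bLX i) (bQX i))
      & (forall i, UY i <=
           swap_bound K (b * (xAx / t)) t n (rad i) (bLY i) (bQY i))].
Proof.
(* The second moment of the change forces 10 = 2 (2^2 + 1); the means need only
   6 = 2 (2 + 1). *)
exists 10%:R; split=> // c C _ n p n0 p0 _ d T P X Y Sigma bLX bQX bLY bQY rad A.
move=> S t x rX rY indX indY indXY X0 Y0 XS YS mX mY _ A0 t0 tA S0 FX FY xAx b.
split.
  exact: (@variance_Ffun_le R n p d T P rad A S t x p0 A0 t0 tA S0 X bLX bQX).
exists (fun i => swap_bound 10%:R (b * (xAx / t)) t n (rad i) (bLX i) (bQX i)).
exists (fun i => swap_bound 10%:R (b * (xAx / t)) t n (rad i) (bLY i) (bQY i)).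
split=> //.
exact: (@mean_Ffun_swap_le R n p d T P rad A S t x n0 p0 A0 t0 tA S0 X Y Sigma).
Qed.
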